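(* Let $(S,X,T)\sim P_{S,X,T}$ be discrete random variables, and for $r\geq 0$, $\epsilon\ge 0$ let $$g^{r}_{\epsilon}(P_{S,X,T})=\sup_{P_{Y\mid S,X,T}:\ I(Y;S)\leq \epsilon,\ I(X;Y)\leq r} I(Y;T).$$ Then for all $r\geq 0$, $\epsilon\geq 0$: $$g^{r}_{\epsilon}(P_{S,X,T})\leq \min\{H(T\mid S)+\epsilon,\ H(T\mid X)+r\}.$$ Moreover, with $L_0 = H(T\mid X,S)-\big(\log(I(X,S;T)+5.51)+1.06\big)$, the following lower bounds hold: 1. If $0\leq r\leq H(X\mid S)+\epsilon$: $\max\{L_0, L_1^{r,\epsilon}, L_2^{r,\epsilon}\}\leq g^{r}_{\epsilon}(P_{S,X,T})$, where, with $\alpha=\frac{r}{H(X\mid S)+\epsilon}$, $L_1^{r,\epsilon} = H(T\mid X,S)+r-H(X,S\mid T)$, $L_2^{r,\epsilon} = H(T\mid X,S)+r-\alpha H(X,S\mid T)-1.06-\log\big((1-\alpha)I(X,S;T)+\alpha\min\{H(T),H(X,S)\}+5.51\big)$. 2. If $H(X\mid S)+\epsilon\leq r< H(X)$: $\max\{L_0, {L'}_1^{r,\epsilon}\}\leq g^{r}_{\epsilon}(P_{S,X,T})$, where ${L'}_1^{r,\epsilon} = H(T\mid S)-H(S\mid T)+\epsilon$. 3. If $r\leq \epsilon\leq H(S\mid X)+r$: $\max\{L_0, L_3^{r,\epsilon}, L_4^{r,\epsilon}\}\leq g^{r}_{\epsilon}(P_{S,X,T})$, where, with $\tilde{\alpha}=\frac{\epsilon}{H(S\mid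 X)+r}$, $L_3^{r,\epsilon} = H(T\mid X,S)+\epsilon-H(X,S\mid T)$, $L_4^{r,\epsilon} = H(T\mid X,S)+\epsilon-\tilde{\alpha} H(X,S\mid T)-1.06-\log\big((1-\tilde{\alpha})I(X,S;T)+\tilde{\alpha}\min\{H(T),H(X,S)\}+5.51\big)$. 4. If $H(S\mid X)+r\leq \epsilon< H(S)$: $\max\{L_0, {L'}_3^{r,\epsilon}\}\leq g^{r}_{\epsilon}(P_{S,X,T})$, where ${L'}_3^{r,\epsilon} = H(T\mid X)-H(X\mid T)+r$.
   Context: $S$ (sensitive attribute) takes values in a finite alphabet $\mathcal{S}$; $X$ (useful data) and $T$ (task) take values in finite or countably infinite alphabets, with finite entropies. $X,S,T$ are arbitrarily correlated (no Markov chain is assumed). The supremum is over all conditional distributions $P_{Y\mid S,X,T}$ of a discrete random variable $Y$ (the representation) given $(S,X,T)$. Standing assumptions: $r<H(X)$ and $\epsilon<H(S)$. Logarithms are base 2. *)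

(* Defs.v *)
From HB Require Import structures.
From mathcomp Require Import all_boot all_order all_algebra.
From mathcomp Require Import all_classical all_reals all_analysis.

Set Implicit Arguments.
Unset Strict Implicit.
Unset Printing Implicit Defensive.

Import Order.TTheory GRing.Theory Num.Theory.
Local Open Scope classical_set_scope.
Local Open Scope ring_scope.

Section Info.
Variable R : realType.

Definition log2 (x : R) : R := ln x / ln 2.

Definition is_pmf (Om : choiceType) (P : Om -> R) : Prop :=
  (forall w, 0 <= P w) /\ (\esum_(w in [set: Om]) (P w)%:E = 1%E).

Variables (Om : choiceType) (P : Om -> R).

Definition dist (A : Type) (f : Om -> A) (a : A) : R :=
  fine (\esum_(w in [set w | f w = a]) (P w)%:E).

Definition entropy (A : choiceType) (f : Om -> A) : \bar R :=
  \esum_(a in [set: A])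
    (let pa := dist f a in if pa == 0 then 0 else - pa * log2 pa)%:E.

Definition centropy (A B : choiceType) (f : Om -> A) (g : Om -> B) : \bar R :=
  \esum_(ab in [set: A * B])
    (let pab := dist (fun w => (f w, g w)) ab in
     let pb := dist g ab.2 in
     if pab == 0 then 0 else - pab * log2 (pab / pb))%:E.

(* mutual information I(f;g) = H(f) - H(f|g) (H(f) finite in all uses) *)
Definition minfo (A B : choiceType) (f : Om -> A) (g : Om -> B) : \bar R :=
  (entropy f - centropy f g)%E.

(* real-valued versions (used only for quantities that are finite) *)
Definition Hr (A : choiceType) (f : Om -> A) : R := fine (entropy f).
Definition Hcr (A B : choiceType) (f : Om -> A) (g : Om -> B) : R :=
  fine (centropy f g).
Definition Ir (A B : choiceType) (f : Om -> A) (g : Om -> B) : R :=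
  fine (minfo f g).

End Info.

Section Privacy.
Variables (R : realType) (S : finType) (X T : countType).

Definition rvS (u : S * X * T) : S := u.1.1.
Definition rvX (u : S * X * T) : X := u.1.2.
Definition rvT (u : S * X * T) : T := u.2.
Definition rvXS (u : S * X * T) : X * S := (u.1.2, u.1.1).

(* joint law of (S,X,T,Y) built from P_{S,X,T} and a kernel P_{Y|S,X,T};
   the representation Y takes values in nat (any countable alphabet). *)
Definition joint (p : S * X * T -> R) (q : S * X * T -> nat -> R)
  (w : (S * X * T) * nat) : R := p w.1 * q w.1 w.2.
Definition yS (w : (S * X * T) * nat) : S := w.1.1.1.
Definition yX (w : (S * X * T) * nat) : X := w.1.1.2.
Definition yT (w : (S * X * T) * nat) : T := w.1.2.
Definition yY (w : (S * X * T) * nat) : nat := w.2.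

Definition is_kernel (q : S * X * T -> nat -> R) : Prop :=
  (forall u y, 0 <= q u y) /\
  (forall u, \esum_(y in [set: nat]) (q u y)%:E = 1%E).

Definition feasible (p : S * X * T -> R) (r eps : R)
  (q : S * X * T -> nat -> R) : Prop :=
  is_kernel q /\
  (minfo (joint p q) yS yY <= eps%:E)%E /\
  (minfo (joint p q) yX yY <= r%:E)%E.

Definition g_priv (p : S * X * T -> R) (r eps : R) : \bar R :=
  ereal_sup [set minfo (joint p q) yT yY | q in feasible p r eps].

End Privacy.

(* Main.v *)
Require Import Defs.
From HB Require Import structures.
From mathcomp Require Import all_boot all_order all_algebra.
From mathcomp Require Import all_classical all_reals all_analysis.
From mathcomp Require finmap.
From mathcomp Require Import ring lra.
Import Order.TTheory GRing.Theory Num.Theory.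
Local Open Scope classical_set_scope.
Local Open Scope ring_scope.
Set Implicit Arguments.
Unset Strict Implicit.
Unset Printing Implicit Defensive.

(** Upper bound: [I(f;Y) <= I(g;Y) + H(f|g)] for all [f], [g].  The same
    inequality shows that leaking at most [eps] bits about [S] leaks at most
    [H(X|S) + eps] bits about [X], which gives feasibility below.

    Lower bounds: representations [Y] of three kinds and time sharing between
    them, i.e. an independent coin, revealed with [Y], that selects one of them.
    - independent copies: with [Y] a list of independent samples
      [T_a ~ P(T | A = a)] and [T = T_A], [Y] is independent of [A] and
      [H(T|Y) <= H(A)], so [I(Y;T) >= H(T) - H(A)];
    - an exponential race: let [X_t] be independent exponential clocks of rate
      [P(T = t)], and [T] the value minimising
      [X_t * P(T = t) / P(T = t | A)].  Then [Y = (X_t)_t] is independent of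
      [A], [T] has the right law, and [T] is described by weights that decay
      like a power of [X_t]; Jensen's inequality bounds the expected length by
      [I(T;A) + log (I(T;A) + 5.51) + 1.06];
    - [Y = T], mixed with independent copies for [A = S] (or [A = X]), at a ratio
      that uses up the leakage allowed for [A].

    Since the kernels are discrete and independence has to be exact, the race is
    run on a grid: uniform clocks replace the exponential ones and are rounded,
    but the winner has law [P(T | A)] exactly.  The theorem is about a supremum,
    so [T] and [A] may be truncated up to an arbitrarily small loss. *)

(** * Sums and information quantities over a discrete space *)

Section Esum.
Context {R : realType}.

Lemma esumZl (I : choiceType) (D : set I) (c : R) (a : I -> \bar R) :
  0 <= c -> (forall i, 0 <= a i)%E ->
  (\esum_(i in D) (c%:E * a i) = c%:E * \esum_(i in D) a i)%E.
Proof.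
move=> c0 a0; rewrite /esum -ereal_supZl//; last first.
  by apply/set0P; exists 0%E; exists set0; [exact: fsets_set0|rewrite fsbig_set0].
congr ereal_sup; rewrite image_comp; apply/seteqP; split=> _ [A AD <-] /=.
- by exists A => //=; rewrite ge0_mule_fsumr.
- by exists A => //=; rewrite ge0_mule_fsumr.
Qed.

Lemma esum_prod (A B : choiceType) (a : A * B -> \bar R) :
  (forall k, 0 <= a k)%E ->
  \esum_(k in [set: A * B]) a k =
  \esum_(i in [set: A]) \esum_(j in [set: B]) a (i, j).
Proof.
move=> a0; rewrite esum_esum//.
have -> : [set: A] `*`` (fun=> [set: B]) = [set: A * B] by apply/seteqP.
by apply: eq_esum => -[].
Qed.

Lemma esum_swap (A B : choiceType) (a : A -> B -> \bar R) :
  (forall i j, 0 <= a i j)%E ->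
  \esum_(i in [set: A]) \esum_(j in [set: B]) a i j =
  \esum_(j in [set: B]) \esum_(i in [set: A]) a i j.
Proof.
move=> a0.
rewrite -(@esum_prod _ _ (fun k => a k.1 k.2))// -(@esum_prod _ _ (fun k => a k.2 k.1))//.
apply: (@reindex_esum _ _ _ [set: B * A] _ (fun k : B * A => (k.2, k.1))).
by split=> // [[i j] [k l] _ _ [-> ->]//|[i j] _]; exists (j, i).
Qed.

Lemma esum_fiber (W A : choiceType) (f : W -> A) (D : set W) (a : W -> \bar R) :
  (forall w, 0 <= a w)%E ->
  \esum_(w in D) a w =
  \esum_(b in [set: A]) \esum_(w in D `&` [set w | f w = b]) a w.
Proof.
move=> a0; rewrite (@esum_esum _ _ _ _ _ (fun=> a))//.
apply/esym/(@reindex_esum _ _ _ D _ (fun w => (f w, w)) (fun k => a k.2)).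
split=> [w Dw //|w w' _ _ [_ ->]//|[b w] [/= _ [Dw <-]]].
by exists w.
Qed.

Lemma esum_fin (I : finType) (a : I -> \bar R) :
  (forall i, 0 <= a i)%E -> \esum_(i in [set: I]) a i = (\sum_i a i)%E.
Proof.
move=> a0; have fI : finite_set [set: I] by exact: finite_finset.
rewrite esum_fset// fsbig_finite//= -big_enum/=; apply: perm_big.
apply: uniq_perm; [exact: finmap.fset_uniq|exact: enum_uniq|move=> i].
by rewrite mem_enum in_fset_set// mem_set.
Qed.

End Esum.

(** A supremum of finite partial sums, hence the expectation only for nonnegative [F]; where an
    integrand could be negative, a constant is added first. *)
Definition Ex (R : realType) (Om : choiceType) (P F : Om -> R) : \bar R :=
  \esum_(w in [set: Om]) (P w * F w)%:E.

Section Pmf.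
Context {R : realType} {Om : choiceType} {P : Om -> R} (hP : is_pmf P).

Let P0 w : 0 <= P w. Proof. exact: hP.1. Qed.

Lemma esum_pmf_le1 (D : set Om) : (\esum_(w in D) (P w)%:E <= 1)%E.
Proof.
rewrite -hP.2 esum_mkcond; apply: le_esum => w _.
by case: ifP; rewrite lee_fin.
Qed.

Lemma distE (A : Type) (f : Om -> A) a :
  (dist P f a)%:E = \esum_(w in [set w | f w = a]) (P w)%:E.
Proof.
rewrite /dist fineK// ge0_fin_numE ?esum_ge0// => [|w _]; last by rewrite lee_fin.
by rewrite (le_lt_trans (esum_pmf_le1 _))// ltry.
Qed.

Lemma dist_ge0 (A : Type) (f : Om -> A) a : 0 <= dist P f a.
Proof. by rewrite -lee_fin distE esum_ge0// => w _; rewrite lee_fin. Qed.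

Lemma dist_le1 (A : Type) (f : Om -> A) a : dist P f a <= 1.
Proof. by rewrite -lee_fin distE esum_pmf_le1. Qed.

Lemma dist_comp_le (A B : Type) (f : Om -> A) (g : Om -> B) a b :
  (forall w, f w = a -> g w = b) -> dist P f a <= dist P g b.
Proof.
move=> fg; rewrite -lee_fin !distE esum_mkcond [leRHS]esum_mkcond.
apply: le_esum => w _; case: ifPn => [|_]; last by case: ifP; rewrite ?lee_fin.
by rewrite inE/= => /fg gw; rewrite mem_set.
Qed.

Lemma dist_gt0 (A : Type) (f : Om -> A) w : 0 < P w -> 0 < dist P f (f w).
Proof.
move=> Pw; rewrite (lt_le_trans Pw)// -lee_fin distE esum_ge//.
exists [set w]; first by split => //; move=> ? ->.
by rewrite fsbig_set1.
Qed.

Lemma esum_dist (A : choiceType) (f : Om -> A) :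
  \esum_(a in [set: A]) (dist P f a)%:E = 1%E.
Proof.
rewrite -hP.2 (esum_fiber f); last by move=> w; rewrite lee_fin.
by apply: eq_esum => a _; rewrite distE setTI.
Qed.

Lemma dist_pair (A B : choiceType) (f : Om -> A) (g : Om -> B) b :
  \esum_(a in [set: A]) (dist P (fun w => (f w, g w)) (a, b))%:E = (dist P g b)%:E.
Proof.
rewrite distE (esum_fiber f); last by move=> w; rewrite lee_fin.
apply: eq_esum => a _; rewrite distE; congr esum.
by apply/seteqP; split=> w /= [-> ->].
Qed.

Lemma Ex_dist (A : choiceType) (f : Om -> A) (F : A -> R) :
  (forall a, 0 <= F a) ->
  Ex P (F \o f) = \esum_(a in [set: A]) (dist P f a * F a)%:E.
Proof.
move=> F0; rewrite /Ex (esum_fiber f) => [|w]; last first.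
  by rewrite lee_fin mulr_ge0//; exact: F0.
apply: eq_esum => a _; rewrite mulrC EFinM distE -esumZl//.
by rewrite setTI; apply: eq_esum => w /= <-; rewrite mulrC.
Qed.

Lemma ExD (F G : Om -> R) : (forall w, 0 <= F w) -> (forall w, 0 <= G w) ->
  Ex P (fun w => F w + G w) = (Ex P F + Ex P G)%E.
Proof.
move=> F0 G0; rewrite /Ex -esumD; try by move=> w _; rewrite lee_fin mulr_ge0.
by apply: eq_esum => w _; rewrite -EFinD mulrDr.
Qed.

Lemma ExZ (c : R) (F : Om -> R) : 0 <= c -> (forall w, 0 <= F w) ->
  Ex P (fun w => c * F w) = (c%:E * Ex P F)%E.
Proof.
move=> c0 F0; rewrite /Ex -esumZl//; last by move=> w; rewrite lee_fin mulr_ge0.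
by apply: eq_esum => w _; rewrite -EFinM mulrCA.
Qed.

Lemma Ex_cst (c : R) : 0 <= c -> Ex P (fun=> c) = c%:E.
Proof.
move=> c0; rewrite -[RHS]mule1 -hP.2 /Ex -esumZl//.
by apply: eq_esum => w _; rewrite -EFinM mulrC.
Qed.

Lemma le_Ex (F G : Om -> R) : (forall w, 0 < P w -> F w <= G w) -> (Ex P F <= Ex P G)%E.
Proof.
move=> FG; apply: le_esum => w _; rewrite lee_fin.
by have := P0 w; rewrite le_eqVlt => /predU1P[<-|Pw]; rewrite ?mul0r// ler_pM2l ?FG.
Qed.

Lemma eq_Ex (F G : Om -> R) : (forall w, 0 < P w -> F w = G w) -> Ex P F = Ex P G.
Proof.
by move=> FG; apply/eqP; rewrite eq_le !le_Ex// => w /FG ->.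
Qed.

Lemma Ex_ge0 (F : Om -> R) : (forall w, 0 <= F w) -> (0 <= Ex P F)%E.
Proof. by move=> F0; apply: esum_ge0 => w _; rewrite lee_fin mulr_ge0. Qed.

(* Change of measure: the density [psi / dist f] has total mass at most
   that of [psi]; the inequality comes from the atoms where [dist f] vanishes. *)
Lemma Ex_density (A : choiceType) (f : Om -> A) (psi : A -> R) :
  (forall a, 0 <= psi a) ->
  (Ex P (fun w => psi (f w) / dist P f (f w))%R <= \esum_(a in [set: A]) (psi a)%:E)%E.
Proof.
move=> psi0; rewrite (@Ex_dist _ f (fun a => psi a / dist P f a)); last first.
  by move=> a; rewrite divr_ge0// dist_ge0.
apply: le_esum => a _; rewrite lee_fin mulrCA.
have [->|d0] := eqVneq (dist P f a) 0; first by rewrite mul0r mulr0.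
by rewrite divff// mulr1.
Qed.


End Pmf.

(** * Base 2 logarithm *)

Section Log2.
Context {R : realType}.
Implicit Types x y : R.

Lemma ln2_gt0 : 0 < ln 2 :> R.
Proof. by rewrite ln_gt0// ltr1n. Qed.

Lemma ln2_ge0 : 0 <= ln 2 :> R. Proof. exact: ltW ln2_gt0. Qed.

Lemma log2M x y : 0 < x -> 0 < y -> log2 (x * y) = log2 x + log2 y.
Proof. by move=> x0 y0; rewrite /log2 lnM ?posrE// mulrDl. Qed.

Lemma log2V x : 0 < x -> log2 x^-1 = - log2 x.
Proof. by move=> x0; rewrite /log2 lnV ?posrE// mulNr. Qed.

Lemma log2_div x y : 0 < x -> 0 < y -> log2 (x / y) = log2 x - log2 y.
Proof. by move=> x0 y0; rewrite log2M ?invr_gt0// log2V. Qed.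

Lemma log2_le0 x : x <= 1 -> log2 x <= 0.
Proof. by move=> x1; rewrite /log2 mulr_le0_ge0 ?ln_le0 ?invr_ge0 ?ln2_ge0. Qed.

Lemma log2_ge0 x : 1 <= x -> 0 <= log2 x.
Proof. by move=> x1; rewrite /log2 divr_ge0 ?ln_ge0 ?ler1n. Qed.

Lemma ler_log2 x y : 0 < x -> x <= y -> log2 x <= log2 y.
Proof.
move=> x0 xy; rewrite /log2 ler_pM2r ?invr_gt0 ?ln2_gt0//.
by rewrite ler_ln ?posrE// (lt_le_trans x0).
Qed.

Lemma log2_le_tangent x : 0 < x -> log2 x <= (ln 2)^-1 * (x - 1).
Proof.
move=> x0; rewrite /log2 mulrC ler_pM2l ?invr_gt0 ?ln2_gt0//.
have /le_ln1Dx : -1 < x - 1 by lra.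
by have -> : 1 + (x - 1) = x by ring.
Qed.

End Log2.

(** * Gibbs' inequality, and entropies as expectations *)

Section Entropy.
Context {R : realType} {Om : choiceType} {P : Om -> R} (hP : is_pmf P).

(** Since [log2 x <= (x - 1) / ln 2], the mean of [log2 (D w)] is at most
    [(Ex P D - 1) / ln 2 <= 0]. The constant [c = 1 / ln 2] is moved to the left side so that all
    integrands are nonnegative. *)
Lemma gibbs (F G D : Om -> R) :
  (forall w, 0 <= F w) -> (forall w, 0 <= G w) -> (forall w, 0 <= D w) ->
  (forall w, 0 < P w -> 0 < D w /\ F w <= G w + log2 (D w)) ->
  (Ex P D <= 1)%E -> (Ex P F <= Ex P G)%E.
Proof.
move=> F0 G0 D0 FGD D1; pose c : R := (ln 2)^-1.
have c0 : 0 <= c by rewrite invr_ge0 ln2_ge0.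
have : (Ex P (fun w => F w + c)%R <= Ex P (fun w => G w + c * D w)%R)%E.
  apply: (le_Ex hP) => w /FGD[Dw /le_trans]; move=> /(_ (G w + c * (D w - 1))).
  by rewrite lerD2l => /(_ (log2_le_tangent Dw)); lra.
rewrite (ExD hP)// (ExD hP)//; last by move=> w; rewrite mulr_ge0.
rewrite (ExZ hP)// (Ex_cst hP)// => h; rewrite -(@leeD2rE _ c%:E)//.
apply: (le_trans h); rewrite leeD2l// -[leRHS]mule1.
by rewrite lee_wpmul2l// lee_fin.
Qed.

Lemma entropyE (A : choiceType) (f : Om -> A) :
  entropy P f = Ex P (fun w => - log2 (dist P f (f w))).
Proof.
rewrite (@Ex_dist _ _ _ hP _ f (fun a => - log2 (dist P f a))); last first.
  by move=> a; rewrite oppr_ge0 log2_le0// dist_le1.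
apply: eq_esum => a _; congr EFin; rewrite mulrN -mulNr.
by rewrite /=; case: eqP => // ->; rewrite oppr0 mul0r.
Qed.

Lemma centropyE (A B : choiceType) (f : Om -> A) (g : Om -> B) :
  centropy P f g = Ex P (fun w =>
    - log2 (dist P (fun w => (f w, g w)) (f w, g w) / dist P g (g w))).
Proof.
pose k w := (f w, g w).
rewrite (@Ex_dist _ _ _ hP _ k
  (fun ab => - log2 (dist P k ab / dist P g ab.2))); last first.
  move=> ab; rewrite oppr_ge0 log2_le0//.
  have := dist_ge0 hP g ab.2; rewrite le_eqVlt => /predU1P[<-|g0].
    by rewrite invr0 mulr0 ler01.
  rewrite ler_pdivrMr// mul1r; apply: (dist_comp_le hP) => w <- //.
apply: eq_esum => ab _; congr EFin; rewrite mulrN -mulNr -/k.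
by rewrite /=; case: eqP => // ->; rewrite oppr0 mul0r.
Qed.

End Entropy.

(** * Chain rule, codes and a triangle inequality for conditional entropy *)

Section Inequalities.
Context {R : realType} {Om : choiceType} (P : Om -> R) (hP : is_pmf P).

Let P0 w : 0 <= P w. Proof. exact: hP.1. Qed.

(* [log2 0 = 0] here, which is harmless: the atoms concerned have weight 0 in [Ex]. *)
Definition self_info (A : choiceType) (f : Om -> A) w := - log2 (dist P f (f w)).

Definition cond_info (A B : choiceType) (f : Om -> A) (g : Om -> B) w :=
  - log2 (dist P (fun w => (f w, g w)) (f w, g w) / dist P g (g w)).

Lemma self_info_ge0 (A : choiceType) (f : Om -> A) w : 0 <= self_info f w.
Proof. by rewrite oppr_ge0 log2_le0// (dist_le1 hP). Qed.

Lemma cond_dist_le1 (A B : choiceType) (f : Om -> A) (g : Om -> B) a b :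
  dist P (fun w => (f w, g w)) (a, b) / dist P g b <= 1.
Proof.
have := dist_ge0 hP g b; rewrite le_eqVlt => /predU1P[<-|g0].
  by rewrite invr0 mulr0 ler01.
by rewrite ler_pdivrMr// mul1r; apply: (dist_comp_le hP) => w [].
Qed.

Lemma cond_info_ge0 (A B : choiceType) (f : Om -> A) (g : Om -> B) w :
  0 <= cond_info f g w.
Proof. by rewrite oppr_ge0 log2_le0// cond_dist_le1. Qed.

Lemma cond_infoE (A B : choiceType) (f : Om -> A) (g : Om -> B) w : 0 < P w ->
  cond_info f g w = self_info (fun w => (f w, g w)) w - self_info g w.
Proof.
move=> Pw; rewrite /cond_info /self_info log2_div; last 2 first.
- exact: (dist_gt0 hP (fun w => (f w, g w))).
- exact: dist_gt0.
by rewrite opprB opprK addrC.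
Qed.

Lemma dist_swap (A B : choiceType) (f : Om -> A) (g : Om -> B) a b :
  dist P (fun w => (f w, g w)) (a, b) = dist P (fun w => (g w, f w)) (b, a).
Proof.
by congr fine; congr esum; apply/seteqP; split=> w /= [-> ->].
Qed.

Lemma entropy_ge0 (A : choiceType) (f : Om -> A) : (0 <= entropy P f)%E.
Proof. by rewrite (entropyE hP) (Ex_ge0 hP)// => w; exact: self_info_ge0. Qed.

Lemma centropy_ge0 (A B : choiceType) (f : Om -> A) (g : Om -> B) :
  (0 <= centropy P f g)%E.
Proof. by rewrite (centropyE hP) (Ex_ge0 hP)// => w; exact: cond_info_ge0. Qed.

Lemma entropy_pair (A B : choiceType) (f : Om -> A) (g : Om -> B) :
  entropy P (fun w => (f w, g w)) = (entropy P g + centropy P f g)%E.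
Proof.
rewrite !(entropyE hP) (centropyE hP) -(ExD hP); last 2 first.
- exact: self_info_ge0.
- exact: cond_info_ge0.
apply: (eq_Ex hP) => w /cond_infoE cE.
by rewrite -/(cond_info f g w) cE /self_info; ring.
Qed.

Lemma entropy_swap (A B : choiceType) (f : Om -> A) (g : Om -> B) :
  entropy P (fun w => (f w, g w)) = entropy P (fun w => (g w, f w)).
Proof. by rewrite !(entropyE hP); apply: (eq_Ex hP) => w _; rewrite dist_swap. Qed.

Lemma centropy_fun (A B : choiceType) (h : B -> A) (g : Om -> B) :
  centropy P (h \o g) g = 0%E.
Proof.
rewrite (centropyE hP); rewrite -[RHS](Ex_cst hP (lexx 0)).
apply: (eq_Ex hP) => w Pw.
have -> : dist P (fun w => ((h \o g) w, g w)) ((h \o g) w, g w) = dist P g (g w).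
  by congr fine; congr esum; apply/seteqP; split=> w' /=[] // ->.
by rewrite divff ?gt_eqF ?(dist_gt0 hP)// /log2 ln1 mul0r oppr0.
Qed.

(* Gibbs' inequality for a code: [W a c] plays the role of a (sub)probability
   assigned to [a] by a decoder that sees [c]. *)
Lemma centropy_code (A C : choiceType) (f : Om -> A) (k : Om -> C)
    (W : A -> C -> R) (G : Om -> R) (x : R) :
  (forall a c, 0 <= W a c) -> (forall w, 0 <= G w) ->
  (forall w, 0 < P w -> 0 < W (f w) (k w) /\ - log2 (W (f w) (k w)) <= G w + x) ->
  (\esum_(c in [set: C]) \esum_(a in [set: A]) (W a c * dist P k c)%:E <= 1)%E ->
  (centropy P f k <= Ex P G + x%:E)%E.
Proof.
move=> W0 G0 WG W1; pose fk w := (f w, k w).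
pose psi ac : R := W ac.1 ac.2 * dist P k ac.2.
have psi0 ac : 0 <= psi ac by rewrite mulr_ge0// (dist_ge0 hP).
(* [x] may be negative; its positive and negative parts go to opposite sides to keep the integrands
   nonnegative. *)
pose xp := Num.max x 0; pose xn := Num.max (- x) 0.
have xE : x = xp - xn by rewrite /xp /xn /Num.max; case: ltP => ?; case: ltP => ?; lra.
have xp0 : 0 <= xp by rewrite le_max lexx orbT.
have xn0 : 0 <= xn by rewrite le_max lexx orbT.
suff : (Ex P (fun w => cond_info f k w + xn)%R <= Ex P (fun w => G w + xp)%R)%E.
  rewrite (ExD hP)// (ExD hP)//; last exact: cond_info_ge0.
  by rewrite !(Ex_cst hP)// (centropyE hP) xE EFinB addeA leeBrDr.
apply: (gibbs hP (D := fun w => psi (fk w) / dist P fk (fk w))) => //.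
- by move=> w; rewrite addr_ge0// cond_info_ge0.
- by move=> w; rewrite addr_ge0.
- by move=> w; rewrite divr_ge0// (dist_ge0 hP).
- move=> w Pw; have [Ww Gw] := WG _ Pw.
  have k0 : 0 < dist P k (k w) by apply: (dist_gt0 hP).
  have fk0 : 0 < dist P fk (fk w) by apply: (dist_gt0 hP).
  rewrite /psi divr_gt0 ?mulr_gt0//; split=> //.
  rewrite /cond_info -/fk -/(fk w) !log2_div ?mulr_gt0// log2M//=.
  by move: Gw; rewrite xE; lra.
- rewrite (le_trans (Ex_density hP fk psi0))// esum_prod//.
  by rewrite esum_swap// => a c; exact: (psi0 (a, c)).
Qed.

(** Conditioning reduces entropy: the decoder ignores [g] and codes with the law of [f]. *)
Lemma centropy_le (A B : choiceType) (f : Om -> A) (g : Om -> B) :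
  (centropy P f g <= entropy P f)%E.
Proof.
rewrite (entropyE hP) -[leRHS]adde0.
apply: (@centropy_code _ _ _ _ (fun a _ => dist P f a)).
- by move=> a _; exact: (dist_ge0 hP).
- exact: self_info_ge0.
- by move=> w Pw; rewrite addr0; split=> //; exact: (dist_gt0 hP).
- rewrite (@eq_esum _ _ _ _ (fun c => (dist P g c)%:E)) ?(esum_dist hP)// => c _.
  under eq_esum do rewrite mulrC EFinM.
  rewrite esumZl ?(dist_ge0 hP)// ?(esum_dist hP) ?mule1// => a.
  by rewrite lee_fin (dist_ge0 hP).
Qed.

(** Gibbs' inequality against the law [psi] under which [g] and [k] are conditionally independent
    given [f], with the same pair laws [(k, f)] and [(g, f)]. *)
Lemma centropy_triangle (A B C : choiceType)
    (f : Om -> A) (g : Om -> B) (k : Om -> C) :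
  (centropy P g k <= centropy P f k + centropy P g f)%E.
Proof.
pose kf w := (k w, f w); pose gf w := (g w, f w); pose fgk w := (f w, (g w, k w)).
pose psi (t : A * (B * C)) : R :=
  dist P kf (t.2.2, t.1) * dist P gf (t.2.1, t.1) / dist P f t.1.
have d0 := fun A f => @dist_ge0 _ _ _ hP A f.
have psi0 t : 0 <= psi t by rewrite divr_ge0 ?mulr_ge0 ?d0.
rewrite !(centropyE hP) -(ExD hP); last 2 first.
- exact: cond_info_ge0.
- exact: cond_info_ge0.
apply: (gibbs hP (D := fun w => psi (fgk w) / dist P fgk (fgk w))) => //.
- exact: cond_info_ge0.
- by move=> w; rewrite addr_ge0//; exact: cond_info_ge0.
- by move=> w; rewrite divr_ge0 ?d0.
- move=> w Pw; have d1 D (h : Om -> D) : 0 < dist P h (h w) by apply: (dist_gt0 hP).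
  have fgk0 := d1 _ fgk; have k0 := d1 _ k; have f0 := d1 _ f.
  have kf0 := d1 _ kf; have gf0 := d1 _ gf.
  have gk0 := d1 _ (fun w => (g w, k w)).
  rewrite /psi !divr_gt0 ?mulr_gt0//; split=> //=.
  rewrite (dist_swap f k) -/kf -/gf -/(kf w) -/(gf w).
  rewrite !log2_div ?divr_gt0 ?mulr_gt0// log2M//.
  (* All other logarithms cancel; this comparison is the whole pointwise slack. *)
  have : log2 (dist P fgk (fgk w)) <= log2 (dist P (fun w => (g w, k w)) (g w, k w)).
    by apply: ler_log2 => //; apply: (dist_comp_le hP) => w' [_ -> ->].
  by lra.
- rewrite (le_trans (Ex_density hP fgk psi0))// esum_prod//.
  rewrite -(esum_dist hP f); apply: le_esum => a _; rewrite esum_prod; last first.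
    by move=> t; rewrite lee_fin.
  rewrite -(dist_pair hP g); apply: le_esum => b _.
  have -> : \esum_(c in [set: C]) (psi (a, (b, c)))%:E =
      ((dist P gf (b, a) / dist P f a)%:E * (dist P f a)%:E)%E.
    rewrite -(dist_pair hP k f a) -esumZl ?divr_ge0 ?d0//; last first.
      by move=> c; rewrite lee_fin d0.
    by apply: eq_esum => c _; rewrite -EFinM /psi/=; congr EFin; ring.
  rewrite -EFinM lee_fin -mulrA.
  have [->|fa0] := eqVneq (dist P f a) 0; first by rewrite mulr0 mulr0 d0.
  by rewrite mulVf// mulr1.
Qed.

End Inequalities.

(** * Sums over even and odd integers *)

Section Parity.
Context {R : realType}.

Lemma esum_parity (a : nat -> \bar R) : (forall n, 0 <= a n)%E ->
  (\esum_(n in [set: nat]) a n =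
   \esum_(n in [set: nat]) a n.*2 + \esum_(n in [set: nat]) a n.*2.+1)%E.
Proof.
move=> a0; rewrite (esumID [set n | ~~ odd n])//; congr (_ + _)%E.
- apply: (@reindex_esum _ _ _ [set: nat] _ double); split=> //.
  + by move=> n _ /=; rewrite odd_double.
  + by move=> m n _ _ /double_inj.
  + by move=> n /= [_ en]; exists n./2 => //; rewrite even_halfK.
- apply: (@reindex_esum _ _ _ [set: nat] _ (fun n => n.*2.+1)); split=> //.
  + by move=> n _ /=; split=> //; rewrite /= odd_double.
  + by move=> m n _ _ [/double_inj].
  + move=> n /= [_ /negP]; rewrite negbK => on; exists n./2 => //=.
    by rewrite -[RHS]odd_double_half on.
Qed.

Lemma fineZ (c : R) (x : \bar R) : fine (c%:E * x) = c * fine x.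
Proof.
case: x => [x| |] //=; rewrite mulr0.
- by rewrite mulry; case: sgrP => _; rewrite ?mul0e ?mul1e ?mulN1e.
- by rewrite mulrNy; case: sgrP => _; rewrite ?mul0e ?mul1e ?mulN1e.
Qed.

End Parity.

(** * Joint laws with a kernel, and time sharing *)

Section Joint.
Context {R : realType} {S : finType} {X T : countType}.
Context {p : S * X * T -> R} (hp : is_pmf p).
Implicit Types q : S * X * T -> nat -> R.
Local Notation Om := (S * X * T)%type.
Local Notation Y := (@yY S X T).

Let p0 u : 0 <= p u. Proof. exact: hp.1. Qed.

Lemma joint_ge0 q w : is_kernel q -> 0 <= joint p q w.
Proof. by move=> [q0 _]; rewrite mulr_ge0. Qed.

Lemma Ex_joint q (F : Om * nat -> R) : is_kernel q -> (forall w, 0 <= F w) ->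
  Ex (joint p q) F =
  \esum_(u in [set: Om]) ((p u)%:E * \esum_(y in [set: nat]) (q u y * F (u, y))%:E)%E.
Proof.
move=> [q0 q1] F0; rewrite /Ex esum_prod; last first.
  by move=> w; rewrite lee_fin !mulr_ge0.
apply: eq_esum => u _; rewrite -esumZl//; last first.
  by move=> y; rewrite lee_fin mulr_ge0.
by apply: eq_esum => y _; rewrite -EFinM mulrA.
Qed.

Lemma joint_pmf q : is_kernel q -> is_pmf (joint p q).
Proof.
move=> qk; split; first by move=> w; exact: joint_ge0.
rewrite -hp.2; have := @Ex_joint q (fun=> 1) qk (fun=> ler01).
rewrite /Ex; under eq_esum do rewrite mulr1; move=> ->.
apply: eq_esum => u _; under eq_esum do rewrite mulr1.
by rewrite qk.2 mule1.
Qed.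

Lemma dist_joint q (A : Type) (f : Om -> A) a : is_kernel q ->
  dist (joint p q) (fun w => f w.1) a = dist p f a.
Proof.
move=> qk; apply: EFin_inj; rewrite (distE (joint_pmf qk)) (distE hp).
have -> : [set w : Om * nat | f w.1 = a] = [set u | f u = a] `*`` (fun=> [set: nat]).
  by apply/seteqP; split=> -[u y] //= [].
rewrite -(@esum_esum _ _ _ _ _ (fun u y => (joint p q (u, y))%:E))//; last first.
  by move=> u y _ _; rewrite lee_fin joint_ge0.
apply: eq_esum => u _; rewrite /joint/=.
under eq_esum do rewrite EFinM.
by rewrite esumZl ?qk.2 ?mule1// => y; rewrite lee_fin qk.1.
Qed.

Lemma entropy_joint q (A : choiceType) (f : Om -> A) : is_kernel q ->
  entropy (joint p q) (fun w => f w.1) = entropy p f.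
Proof. by move=> qk; apply: eq_esum => a _; rewrite dist_joint. Qed.

Lemma centropy_joint q (A B : choiceType) (f : Om -> A) (g : Om -> B) :
  is_kernel q ->
  centropy (joint p q) (fun w => f w.1) (fun w => g w.1) = centropy p f g.
Proof.
move=> qk; apply: eq_esum => a _; rewrite dist_joint//.
by rewrite (dist_joint (fun u => (f u, g u))).
Qed.

Lemma dist_jointY q (A : Type) (f : Om -> A) a y : is_kernel q ->
  dist (joint p q) (fun w => (f w.1, Y w)) (a, y) =
  fine (\esum_(u in [set u | f u = a]) (p u * q u y)%:E).
Proof.
move=> qk; congr fine.
apply: (@reindex_esum _ _ _ _ _ (fun u => (u, y))); split.
- by move=> u /= ->.
- by move=> u v _ _ [].
- by move=> [u z] /= [fu <-]; exists u.
Qed.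

Lemma dist_Y q y : is_kernel q ->
  dist (joint p q) Y y = fine (\esum_(u in [set: Om]) (p u * q u y)%:E).
Proof.
move=> qk; congr fine.
apply: (@reindex_esum _ _ _ _ _ (fun u => (u, y))); split=> //.
- by move=> u v _ _ [].
- by move=> [u z] /= <-; exists u.
Qed.

(** The parity of the letter is the coin, so the coin is revealed with the letter. *)
Definition time_share (lam : R) q0 q1 : Om -> nat -> R := fun u y =>
  if odd y then lam * q1 u y./2 else (1 - lam) * q0 u y./2.

Lemma time_share_even lam q0 q1 u y : time_share lam q0 q1 u y.*2 = (1 - lam) * q0 u y.
Proof. by rewrite /time_share odd_double doubleK. Qed.

Lemma time_share_odd lam q0 q1 u y : time_share lam q0 q1 u y.*2.+1 = lam * q1 u y.
Proof. by rewrite /time_share /= odd_double/= uphalf_double. Qed.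

Lemma time_share_kernel lam q0 q1 : 0 <= lam <= 1 -> is_kernel q0 -> is_kernel q1 ->
  is_kernel (time_share lam q0 q1).
Proof.
move=> /andP[l0 l1] k0 k1; have l1' : 0 <= 1 - lam by rewrite subr_ge0.
have ts0 u y : 0 <= time_share lam q0 q1 u y.
  by rewrite /time_share; case: ifP => _; rewrite mulr_ge0 ?k0.1 ?k1.1.
split=> // u; rewrite esum_parity//; last by move=> y; rewrite lee_fin.
under eq_esum do rewrite time_share_even EFinM.
under [X in (_ + X)%E]eq_esum do rewrite time_share_odd EFinM.
rewrite !esumZl//; [|by move=> y; rewrite lee_fin k1.1|by move=> y; rewrite lee_fin k0.1].
by rewrite k0.2 k1.2 !mule1 -EFinD subrK.
Qed.

(** On letters of one parity the joint mass and the marginal mass are scaled by the same factor, and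
    the summand [term] of conditional entropy is homogeneous of degree 1. *)
Lemma centropy_time_share lam q0 q1 (A : choiceType) (f : Om -> A) :
  0 <= lam <= 1 -> is_kernel q0 -> is_kernel q1 ->
  centropy (joint p (time_share lam q0 q1)) (fun w => f w.1) Y =
  ((1 - lam)%:E * centropy (joint p q0) (fun w => f w.1) Y +
   lam%:E * centropy (joint p q1) (fun w => f w.1) Y)%E.
Proof.
move=> lam01 k0 k1; have /andP[l0 l1] := lam01.
have kt := time_share_kernel lam01 k0 k1.
have l1' : 0 <= 1 - lam by rewrite subr_ge0.
pose term (a b : R) : R := if a == 0 then 0 else - a * log2 (a / b).
have termZ c a b : 0 <= c -> term (c * a) (c * b) = c * term a b.
  rewrite /term le_eqVlt => /predU1P[<-|c0]; first by rewrite !mul0r eqxx.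
  rewrite mulf_eq0 (gt_eqF c0)/=; case: eqP => _; first by rewrite mulr0.
  by rewrite -mulf_div divff ?gt_eqF// mul1r; ring.
pose D q a y := dist (joint p q) (fun w => (f w.1, Y w)) (a, y).
pose DY q y := dist (joint p q) Y y.
have term0 q a y : is_kernel q -> (0 <= (term (D q a y) (DY q y))%:E)%E.
  move=> kq; have jq := joint_pmf kq; rewrite lee_fin /term; case: ifP => // _.
  rewrite mulNr -mulrN mulr_ge0 ?(dist_ge0 jq)// oppr_ge0 log2_le0//.
  exact: (cond_dist_le1 jq (fun w => f w.1) Y).
have cE q : is_kernel q -> centropy (joint p q) (fun w => f w.1) Y =
    \esum_(a in [set: A]) \esum_(y in [set: nat]) (term (D q a y) (DY q y))%:E.
  by move=> kq; rewrite /centropy esum_prod// => -[a y]; exact: term0.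
rewrite !cE// -!esumZl//; try by move=> a; apply: esum_ge0 => y _; exact: term0.
rewrite -esumD; try by move=> a _; rewrite mule_ge0// esum_ge0// => y _; exact: term0.
apply: eq_esum => a _; rewrite esum_parity; last by move=> y; exact: term0.
have scal q (D' : set Om) c (g : Om -> R) : 0 <= c -> (forall u, 0 <= g u) ->
    fine (\esum_(u in D') (p u * (c * g u))%:E) =
    c * fine (\esum_(u in D') (p u * g u)%:E).
  move=> c0 g0; rewrite -fineZ -esumZl//; last first.
    by move=> u; rewrite lee_fin mulr_ge0.
  by congr fine; apply: eq_esum => u _; rewrite -EFinM mulrCA.
rewrite -!esumZl//; try by move=> y; exact: term0.
congr (_ + _)%E; apply: eq_esum => y _; rewrite -EFinM -termZ//; congr (term _ _)%:E.
- rewrite /D !dist_jointY//; under eq_esum do rewrite time_share_even.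
  by rewrite scal// => u; exact: k0.1.
- rewrite /DY !dist_Y//; under eq_esum do rewrite time_share_even.
  by rewrite scal// => u; exact: k0.1.
- rewrite /D !dist_jointY//; under eq_esum do rewrite time_share_odd.
  by rewrite scal// => u; exact: k1.1.
- rewrite /DY !dist_Y//; under eq_esum do rewrite time_share_odd.
  by rewrite scal// => u; exact: k1.1.
Qed.

End Joint.

(** * The race on a grid *)

Section Race.
Context {R : realType}.

(** Once [g] is absorbed into the factor [i0], the sum over functions is a product of sums, and the
    other factors equal 1. *)
Lemma prod_marginal (I J : finType) (F : I -> J -> R) (g : J -> R) i0 :
  (forall i, \sum_j F i j = 1) ->
  \sum_(y : {ffun I -> J}) (\prod_i F i (y i)) * g (y i0) = \sum_j F i0 j * g j.
Proof.
move=> F1; pose F' i j := F i j * (if i == i0 then g j else 1).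
transitivity (\sum_(y : {ffun I -> J}) \prod_i F' i (y i)).
  apply: eq_bigr => y _; rewrite big_split/=; congr (_ * _).
  by rewrite (bigD1 i0)//= eqxx big1 ?mulr1// => i /negbTE ->.
rewrite -bigA_distr_bigA (bigD1 i0)//= [X in _ * X]big1 ?mulr1 => [|i /negbTE ii].
  by apply: eq_bigr => j _; rewrite /F' eqxx.
by rewrite /F' ii -[RHS](F1 i); apply: eq_bigr => j _; rewrite mulr1.
Qed.

Lemma prod_total (I J : finType) (F : I -> J -> R) :
  (forall i, \sum_j F i j = 1) ->
  \sum_(y : {ffun I -> J}) \prod_i F i (y i) = 1.
Proof. by move=> F1; rewrite -bigA_distr_bigA big1. Qed.

(** If [W k] is the product taking [b] below [k] and [a] from [k] on, the summand at [t] is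
    [W t - W t.+1]. *)
Lemma prod_telescope n (a b : 'I_n -> R) :
  \sum_(t < n) \prod_(s < n) (if (s < t)%N then b s else if s == t then a s - b s else a s) =
  \prod_(s < n) a s - \prod_(s < n) b s.
Proof.
pose W k := \prod_(s < n) (if (s < k)%N then b s else a s).
transitivity (\sum_(t < n) (W t - W t.+1)).
  apply: eq_bigr => t _.
  have E k : W k = (if (t < k)%N then b t else a t) *
      \prod_(s < n | s != t) (if (s < k)%N then b s else a s).
    by rewrite /W (bigD1 t).
  rewrite (bigD1 t)//= !E ltnn ltnSn eqxx.
  set p1 := \prod_(i < n | _) _; set p2 := \prod_(i < n | _) _.
  set p3 := \prod_(i < n | _) _.
  have -> : p3 = p1 by apply: eq_bigr => s /negbTE ->.
  have -> : p2 = p1.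
    apply: eq_bigr => s st; rewrite ltnS leq_eqVlt.
    by have -> : (s == t :> nat) = false by apply/negbTE.
  by rewrite mulrBl.
rewrite -(big_mkord xpredT (fun t => W t - W t.+1)).
have -> : \sum_(0 <= t < n) (W t - W t.+1) = - \sum_(0 <= t < n) (W t.+1 - W t).
  by rewrite -sumrN; apply: eq_bigr => t _; rewrite opprB.
rewrite telescope_sumr// opprB /W; congr (_ - _); apply: eq_bigr => s _ //.
by rewrite ltn_ord.
Qed.

(** The full series sums to [(1 - x) ^- 2]; the closed form of the partial sums shows that the
    remainder is nonnegative. *)
Lemma geometric_moment_le1 (x : R) m : 0 <= x <= 1 ->
  (1 - x) ^+ 2 * (\sum_(i < m) i.+1%:R * x ^+ i) <= 1.
Proof.
move=> /andP[x0 x1].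
have -> : (1 - x) ^+ 2 * (\sum_(i < m) i.+1%:R * x ^+ i) =
    1 - x ^+ m * (1 + m%:R * (1 - x)).
  elim: m => [|m IH]; first by rewrite big_ord0 expr0; ring.
  by rewrite big_ord_recr/= mulrDr IH (exprS x) -natr1; ring.
by rewrite gerBl mulr_ge0 ?exprn_ge0// addr_ge0// mulr_ge0// subr_ge0.
Qed.

(** [P] stands for the law of [T] given [A = a], and [Q] for its unconditional law. [eta] is the
    probability that a stage has a winner if nobody won before, [delta] the mesh, [K] the last cell
    and [M] the number of stages. *)
Context (n : nat) (P Q : 'I_n -> R) (eta delta : R) (K M : nat).
Local Notation board := {ffun 'I_n -> 'I_K.+1}.
Hypothesis P0 : forall t, 0 <= P t.
Hypothesis P1 : \sum_(t < n) P t = 1.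
Hypothesis Q0 : forall t, 0 <= Q t.
Hypothesis eta01 : 0 < eta < 1.
Hypothesis delta0 : 0 < delta.

(* The clock of [s] is [U / Q s] with [U] uniform on [0, 1], rounded down to a
   multiple of [delta]; [level s j] is the value of [1 - U] at which the rounded
   clock passes from [j - 1] to [j], and the last cell [K] takes all the rest. *)
Definition level (s : 'I_n) (j : nat) : R :=
  if (j == K.+1)%N then 0 else Num.max 0 (1 - Q s * delta * j%:R).

(* Mass of the rounded value [j] on the event [1 - U <= x]. *)
Definition cell (s : 'I_n) (j : nat) (x : R) : R :=
  Num.min x (level s j) - Num.min x (level s j.+1).

(** Probability that all clocks below [k] survive a stage, given that they survived the previous
    ones. *)
Definition rest (k : nat) : R := 1 - eta * \sum_(s < n | (s < k)%N) P s.

(* Survival probability of [s] in one stage of the race.  Ties inside a stage are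
   broken by the order of the indices; this choice of [rho] makes [t] win a
   stage with probability exactly [eta * P t]. *)
Definition rho (s : 'I_n) : R := rest s.+1 / rest s.

(** Clock [s] survives [m] stages when [1 - U <= rho s ^+ m]. Here all clocks survive [m] stages,
    those below [t] also survive the next one, and [t] falls in it; those above [t] are free in that
    stage. *)
Definition stage (m : nat) (t : 'I_n) (y : board) : R :=
  \prod_(s < n) (if (s < t)%N then cell s (y s) (rho s ^+ m.+1) else
           if s == t then cell s (y s) (rho s ^+ m) - cell s (y s) (rho s ^+ m.+1)
           else cell s (y s) (rho s ^+ m)).

(* Joint law of the winner and of the rounded clocks; if nobody wins during
   [M] stages, the winner is drawn from [P]. *)
Definition race (t : 'I_n) (y : board) : R :=
  \sum_(m < M) stage m t y + P t * \prod_(s < n) cell s (y s) (rho s ^+ M).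

Let eta0 : 0 < eta. Proof. by case/andP: eta01. Qed.
Let eta1 : 0 < 1 - eta. Proof. by rewrite subr_gt0; case/andP: eta01. Qed.

Lemma restS (s : 'I_n) : rest s.+1 = rest s - eta * P s.
Proof.
rewrite /rest (bigD1 s)//= (eq_bigl (fun i : 'I_n => (i < s)%N)); first by ring.
move=> i; rewrite ltnS leq_eqVlt -val_eqE/=; case: eqVneq => [->|_].
  by rewrite ltnn andbF.
by rewrite andbT.
Qed.

Lemma rest_ge k : 1 - eta <= rest k.
Proof.
rewrite /rest lerB// -[leRHS]mulr1 ler_pM2l// -P1 [leRHS](bigID (fun s : 'I_n => (s < k)%N))/=.
by rewrite lerDl sumr_ge0.
Qed.

Lemma rest_gt0 k : 0 < rest k.
Proof. exact: lt_le_trans eta1 (rest_ge k). Qed.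

Lemma rho_prod k : (k <= n)%N -> \prod_(s < n | (s < k)%N) rho s = rest k.
Proof.
elim: k => [|k IH] kn.
  by rewrite big_pred0// /rest big_pred0// mulr0 subr0.
rewrite (bigD1 (Ordinal kn))//= (eq_bigl (fun i : 'I_n => (i < k)%N)); last first.
  move=> i; rewrite ltnS leq_eqVlt -val_eqE/=; case: eqVneq => [->|_].
    by rewrite ltnn andbF.
  by rewrite andbT.
by rewrite IH ?(ltnW kn)// /rho/= divfK// gt_eqF ?rest_gt0.
Qed.

Lemma rho_prodT : \prod_(s < n) rho s = 1 - eta.
Proof.
rewrite (eq_bigl (fun s : 'I_n => (s < n)%N)) => [|s]; last by rewrite ltn_ord.
rewrite rho_prod// /rest -{2}[eta]mulr1 -P1.
by congr (_ - _ * _); apply: eq_bigl => s; rewrite ltn_ord.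
Qed.

Lemma rho_gt0 s : 0 < rho s.
Proof. by rewrite divr_gt0// rest_gt0. Qed.

Lemma one_sub_rho s : 1 - rho s = eta * P s / rest s.
Proof.
have r0 := rest_gt0 s; rewrite /rho restS; field; exact: lt0r_neq0.
Qed.

Lemma rho_le1 s : rho s <= 1.
Proof. by rewrite -subr_ge0 one_sub_rho divr_ge0 ?mulr_ge0 ?(ltW eta0) ?(ltW (rest_gt0 _)). Qed.

Lemma level_ge0 s j : 0 <= level s j.
Proof. by rewrite /level; case: ifP => // _; rewrite le_max lexx. Qed.

Lemma level0 s : level s 0 = 1.
Proof. by rewrite /level/= mulr0 subr0; apply/max_idPr. Qed.

Lemma levelK s : level s K.+1 = 0.
Proof. by rewrite /level eqxx. Qed.

Lemma levelS s j : (j <= K)%N -> level s j.+1 <= level s j.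
Proof.
move=> jK; rewrite {2}/level ltn_eqF// /level; case: ifP => _.
  by rewrite le_max lexx.
rewrite ge_max !le_max lexx/= lerB ?orbT// ler_wpM2l ?mulr_ge0 ?(ltW delta0)//.
by rewrite ler_nat.
Qed.

Lemma cell_sum s x : 0 <= x <= 1 -> \sum_(j < K.+1) cell s j x = x.
Proof.
move=> /andP[x0 x1]; rewrite -(big_mkord xpredT (fun j => cell s j x)).
have -> : \sum_(0 <= j < K.+1) cell s j x =
    - \sum_(0 <= j < K.+1) (Num.min x (level s j.+1) - Num.min x (level s j)).
  by rewrite -sumrN; apply: eq_bigr => j _; rewrite opprB.
rewrite (telescope_sumr (fun j => Num.min x (level s j)))// levelK level0 opprB.
by rewrite (min_idPl x1) (min_idPr x0) subr0.
Qed.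

Lemma cell_ge0 s j x : (j <= K)%N -> 0 <= cell s j x.
Proof. by move=> jK; rewrite subr_ge0 le_min2// levelS. Qed.

Lemma cell_le s j x x' : (j <= K)%N -> x' <= x -> cell s j x' <= cell s j x.
Proof.
move=> jK xx; have := levelS s jK; rewrite /cell /Num.min.
by case: ltP => ?; case: ltP => ?; case: ltP => ?; case: ltP => ? ?; lra.
Qed.

(* If the two masses differ, then [x' < level s j], so [Q s * delta * j < 1 - x']. *)
Lemma cell_diff s j (x x' : R) : (j <= K)%N -> 0 <= x' <= x ->
  Q s * delta * j%:R * (cell s j x - cell s j x') <=
  (1 - x') * (cell s j x - cell s j x').
Proof.
move=> jK /andP[x0 xx]; have lS := levelS s jK.
have [lx|xl] := leP (level s j) x'.
  rewrite /cell !(min_idPr _) ?subrr ?mulr0//; lra.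
rewrite ler_wpM2r ?subr_ge0 ?cell_le//.
by move: xl; rewrite /level ltn_eqF// lt_max => /orP[]; lra.
Qed.

Let rhoX01 m s : 0 <= rho s ^+ m <= 1.
Proof. by rewrite exprn_ge0 ?exprn_ile1 ?rho_le1 ?(ltW (rho_gt0 s)). Qed.

Let rhoXS m s : rho s ^+ m.+1 <= rho s ^+ m.
Proof. by rewrite exprS ler_piMl ?rho_le1 ?exprn_ge0 ?(ltW (rho_gt0 s)). Qed.

Let ordK (j : 'I_K.+1) : (j <= K)%N. Proof. by rewrite -ltnS. Qed.

Lemma stage_ge0 m t y : 0 <= stage m t y.
Proof.
apply: prodr_ge0 => s _; case: ifP => _; first exact: cell_ge0.
by case: ifP => _; rewrite ?cell_ge0// subr_ge0 cell_le.
Qed.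

Lemma race_ge0 t y : 0 <= race t y.
Proof.
rewrite addr_ge0 ?sumr_ge0 ?mulr_ge0 ?prodr_ge0// => [m _|s _].
- exact: stage_ge0.
- exact: cell_ge0.
Qed.

(** The clocks are independent, so the sum factors. Surviving [m] stages gives [(1 - eta) ^+ m]; the
    clocks below [t] give [rest t], which cancels the denominator in [1 - rho t]. *)
Lemma stage_sum m t : \sum_(y : board) stage m t y = (1 - eta) ^+ m * (eta * P t).
Proof.
pose F (s : 'I_n) (j : 'I_K.+1) := if (s < t)%N then cell s j (rho s ^+ m.+1) else
  if s == t then cell s j (rho s ^+ m) - cell s j (rho s ^+ m.+1)
  else cell s j (rho s ^+ m).
rewrite -(bigA_distr_bigA F).
transitivity (\prod_(s < n) rho s ^+ m *
    \prod_(s < n) (if (s < t)%N then rho s else if s == t then 1 - rho s else 1)).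
  rewrite -big_split/=; apply: eq_bigr => s _; rewrite /F.
  case: ifP => _; first by rewrite cell_sum// exprS mulrC.
  case: ifP => _; last by rewrite cell_sum// mulr1.
  by rewrite sumrB !cell_sum// exprS mulrBr mulr1 [rho s * _]mulrC.
rewrite prodrXl rho_prodT; congr (_ * _).
rewrite (bigD1 t)//= ltnn eqxx one_sub_rho (_ : \prod_(s < n | s != t) _ = rest t).
  by rewrite divfK// lt0r_neq0// rest_gt0.
rewrite -(rho_prod (ltnW (ltn_ord t))) [RHS]big_mkcond [RHS](bigD1 t)//= ltnn mul1r.
by apply: eq_bigr => s /negbTE ->.
Qed.

(** The stages give a truncated geometric series and the final draw from [P] supplies exactly the
    missing mass: the discretisation does not disturb the law of the winner. *)
Lemma race_sum t : \sum_y race t y = P t.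
Proof.
rewrite big_split/= exchange_big/= -big_distrr/=.
rewrite -(bigA_distr_bigA (fun (s : 'I_n) (j : 'I_K.+1) => cell s j (rho s ^+ M))).
under [X in _ + _ * X]eq_bigr do rewrite cell_sum//.
rewrite prodrXl rho_prodT; under eq_bigr do rewrite stage_sum.
rewrite -big_distrl/= -(big_mkord xpredT (fun m => (1 - eta) ^+ m)).
have H := subrX1 (1 - eta) M.
rewrite big_mkord mulrA.
have -> : (\sum_(i < M) (1 - eta) ^+ i) * eta = 1 - (1 - eta) ^+ M.
  by rewrite -[RHS]opprB H; ring.
by ring.
Qed.

(** Telescoping over the winner inside a stage, then over the stages. The right side does not
    involve [P], which is what makes the board independent of [A]. *)
Lemma race_marginal y : \sum_t race t y = \prod_(s < n) cell s (y s) 1.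
Proof.
rewrite big_split/= exchange_big/= -big_distrl/= P1 mul1r.
under eq_bigr do rewrite prod_telescope.
pose G m := \prod_(s < n) cell s (y s) (rho s ^+ m).
rewrite -(big_mkord xpredT (fun m => G m - G m.+1)).
have -> : \sum_(0 <= m < M) (G m - G m.+1) = - \sum_(0 <= m < M) (G m.+1 - G m).
  by rewrite -sumrN; apply: eq_bigr => t _; rewrite opprB.
by rewrite telescope_sumr// opprB subrK.
Qed.

Lemma cell1_sum t (g : nat -> R) :
  \sum_(y : board) (\prod_(s < n) cell s (y s) 1) * g (y t) =
  \sum_(j < K.+1) cell t j 1 * g j.
Proof.
apply: (@prod_marginal _ _ (fun s (j : 'I_K.+1) => cell s j 1) (fun j => g j)) => s.
by rewrite cell_sum// ler01 lexx.
Qed.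

(** The last cell collects the remaining tail; the hypothesis makes [K] large enough for it to obey
    the same bound as the others. *)
Lemma cell1_le t j : (j <= K)%N -> 1 <= Q t * delta * K.+1%:R ->
  cell t j 1 <= Q t * delta.
Proof.
move=> jK QK; rewrite /cell; have qd : 0 <= Q t * delta by rewrite mulr_ge0// ltW.
have l1 i : level t i <= 1.
  by rewrite /level; case: ifP => // _; rewrite ge_max ler01/= gerBl mulr_ge0.
rewrite !(min_idPr (l1 _)) {1}/level ltn_eqF//.
have lS : 1 - Q t * delta * j.+1%:R <= level t j.+1.
  rewrite /level; case: eqP => [->|_]; first by rewrite subr_le0.
  by rewrite le_max lexx orbT.
rewrite lerBlDr ge_max addr_ge0 ?level_ge0//=.
by move: lS; rewrite -natr1; lra.
Qed.

(** If [t] wins at stage [m], its clock is at most [1 - rho t ^+ m.+1 <= m.+1 * (1 - rho t)], up to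
    the factor [Q t * delta]. Averaging over the geometric stage number gives the first term; the
    second bounds the clock by [K] when no stage has a winner. *)
Lemma race_moment t :
  Q t * delta * (\sum_y race t y * (y t)%:R) <=
  P t * (P t / (1 - eta) + Q t * delta * K%:R * (1 - eta) ^+ M).
Proof.
have qd : 0 <= Q t * delta by rewrite mulr_ge0// ltW.
have bern (x : R) m : 0 <= x <= 1 -> 1 - x ^+ m <= m%:R * (1 - x).
  move=> /andP[x0 x1]; elim: m => [|m IH]; first by rewrite expr0; lra.
  have xm : x ^+ m <= 1 by rewrite exprn_ile1.
  by rewrite exprS -natr1; nra.
have st_le m (y : board) : Q t * delta * (y t)%:R * stage m t y <=
    m.+1%:R * (1 - rho t) * stage m t y.
  rewrite /stage (bigD1 t)//= ltnn eqxx mulrA [leRHS]mulrA ler_wpM2r//.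
    apply: prodr_ge0 => s _; case: ifP => _; first exact: cell_ge0.
    by case: ifP => _; rewrite ?cell_ge0// subr_ge0 cell_le.
  have /andP[r0 _] := rhoX01 m.+1 t.
  rewrite (le_trans (cell_diff t (ordK (y t)) _))// ?r0 ?rhoXS//.
  rewrite ler_wpM2r ?subr_ge0 ?cell_le//.
  by rewrite bern// rho_le1 ltW ?rho_gt0.
rewrite mulr_sumr.
have -> : \sum_(y : board) Q t * delta * (race t y * (y t)%:R) =
    \sum_(m < M) \sum_(y : board) Q t * delta * (y t)%:R * stage m t y +
    P t * (Q t * delta) * \sum_(y : board)
      (\prod_(s < n) cell s (y s) (rho s ^+ M)) * (y t)%:R.
  rewrite exchange_big mulr_sumr -big_split/=; apply: eq_bigr => y _.
  by rewrite /race -mulr_sumr; ring.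
rewrite mulrDr lerD//.
- have le1 : \sum_(m < M) \sum_(y : board) Q t * delta * (y t)%:R * stage m t y <=
      (1 - rho t) * P t * eta * \sum_(m < M) m.+1%:R * (1 - eta) ^+ m.
    rewrite mulr_sumr; apply: ler_sum => m _.
    apply: (@le_trans _ _ (\sum_(y : board) m.+1%:R * (1 - rho t) * stage m t y)).
      by apply: ler_sum => y _; exact: st_le.
    by rewrite -mulr_sumr stage_sum le_eqVlt; apply/orP; left; apply/eqP; ring.
  apply: (le_trans le1).
  have mom : eta ^+ 2 * (\sum_(m < M) m.+1%:R * (1 - eta) ^+ m) <= 1.
    have := @geometric_moment_le1 (1 - eta) M; rewrite subKr; apply.
    by rewrite ltW//= gerBl ltW.
  set s := \sum_(m < M) _ in mom *.
  have r0 := rest_gt0 t; rewrite one_sub_rho.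
  have -> : eta * P t / rest t * P t * eta * s = P t * (P t / rest t) * (eta ^+ 2 * s).
    by field; exact: lt0r_neq0.
  have PP : 0 <= P t * (P t / rest t) by rewrite mulr_ge0// divr_ge0// ltW.
  apply: le_trans (ler_wpM2l PP mom) _; rewrite mulr1 ler_wpM2l// ler_wpM2l//.
  by rewrite lef_pV2 ?posrE// rest_ge.
- rewrite -!mulrA ler_wpM2l// [leRHS]mulrA mulrA ler_wpM2l//.
  rewrite -rho_prodT -prodrXl mulrC.
  have -> : \prod_(s < n) rho s ^+ M =
      \sum_(y : board) \prod_(s < n) cell s (y s) (rho s ^+ M).
    rewrite -(bigA_distr_bigA (fun (s : 'I_n) (j : 'I_K.+1) => cell s j (rho s ^+ M))).
    by apply: eq_bigr => s _; rewrite cell_sum.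
  rewrite mulr_suml; apply: ler_sum => y _; rewrite ler_wpM2l ?ler_nat//.
  by apply: prodr_ge0 => s _; rewrite cell_ge0.
Qed.

End Race.

(** * Finite codebooks as kernels *)

Section Lift.
Context {R : realType} {S : finType} {X T : countType}.
Context {p : S * X * T -> R} (hp : is_pmf p).
Local Notation Om := (S * X * T)%type.
Local Notation Y := (@yY S X T).

Context {L : finType} (y0 : L) {k : Om -> L -> R}.
Hypothesis k0 : forall u y, 0 <= k u y.
Hypothesis k1 : forall u, \sum_y k u y = 1.

Let p0 u : 0 <= p u. Proof. exact: hp.1. Qed.

Definition lift_kernel (k : Om -> L -> R) (u : Om) (i : nat) : R :=
  \sum_(y | pickle y == i) k u y.

(** Decodes [pickle]; the default [y0] is taken only at integers without mass. *)
Definition letter (i : nat) : L := odflt y0 (unpickle i).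

Lemma pickleLK y : letter (pickle y) = y.
Proof. by rewrite /letter pickleK. Qed.

Lemma esum_lift u (F : nat -> R) : (forall i, 0 <= F i) ->
  \esum_(i in [set: nat]) (lift_kernel k u i * F i)%:E =
  (\sum_y k u y * F (pickle y))%:E.
Proof.
move=> F0.
transitivity (\esum_(i in [set: nat])
    (\sum_(y : L) (if pickle y == i then k u y * F (pickle y) else 0)%:E)%E).
  apply: eq_esum => i _; rewrite sumEFin; congr EFin.
  rewrite /lift_kernel mulr_suml [LHS]big_mkcond; apply: eq_bigr => y _.
  by case: eqP => // ->.
rewrite esum_sum; last by move=> i y _ _; rewrite lee_fin; case: ifP => // _; rewrite mulr_ge0.
rewrite -sumEFin; apply: eq_bigr => y _.
rewrite (esumID [set pickle y]); last first.
  by move=> i _; rewrite lee_fin; case: ifP => // _; rewrite mulr_ge0.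
rewrite [X in (_ + X)%E]esum1 ?adde0; last first.
  by move=> i [_ /= /eqP iy]; rewrite eq_sym (negbTE iy).
by rewrite setTI esum_set1 ?eqxx// lee_fin mulr_ge0.
Qed.

Lemma lift_kernelP : is_kernel (lift_kernel k).
Proof.
split=> u; first by move=> i; exact: sumr_ge0.
have := @esum_lift u (fun=> 1) (fun=> ler01).
under eq_esum do rewrite mulr1; move=> ->.
by under eq_bigr do rewrite mulr1; rewrite k1.
Qed.

Lemma Ex_lift (F : Om -> L -> R) : (forall u y, 0 <= F u y) ->
  Ex (joint p (lift_kernel k)) (fun w => F w.1 (letter w.2)) =
  \esum_(u in [set: Om]) (p u * \sum_y k u y * F u y)%:E.
Proof.
move=> F0; rewrite (@Ex_joint _ _ _ _ _ hp _ (fun w => F w.1 (letter w.2)) lift_kernelP)//.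
apply: eq_esum => u _; rewrite (esum_lift u (F := fun i => F u (letter i)))//.
by rewrite EFinM; under eq_bigr do rewrite pickleLK.
Qed.

Lemma lift_gt0 u i : 0 < lift_kernel k u i -> 0 < k u (letter i).
Proof.
move=> q0; have [y /eqP <- ky] : exists2 y : L, pickle y == i & 0 < k u y.
  apply: contrapT => nky; move: q0; rewrite /lift_kernel big1 ?ltxx// => y yi.
  apply/eqP; rewrite eq_le k0 andbT leNgt; apply/negP => ky.
  by apply: nky; exists y.
by rewrite pickleLK.
Qed.

(** For a given letter the code weights may have total mass above 1; only the mean of the bound [V]
    under the law [mu] of the letter is constrained. The code of the race uses this freedom. *)
Lemma centropy_lift (A : choiceType) (f : Om -> A) (mu : L -> R)
    (W : A -> L -> R) (V : L -> R) (G : Om -> L -> R) (x : R) :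
  (forall y, \esum_(u in [set: Om]) (p u * k u y)%:E = (mu y)%:E) ->
  (forall a y, 0 <= W a y) -> (forall u y, 0 <= G u y) -> (forall y, 0 <= V y) ->
  (forall u y, 0 < p u -> 0 < k u y ->
    0 < W (f u) y /\ - log2 (W (f u) y) <= G u y + x) ->
  (forall y, \esum_(a in [set: A]) (W a y)%:E <= (V y)%:E)%E ->
  \sum_y mu y * V y <= 1 ->
  (centropy (joint p (lift_kernel k)) (fun w => f w.1) Y <=
   \esum_(u in [set: Om]) (p u * \sum_y k u y * G u y)%:E + x%:E)%E.
Proof.
move=> muE W0 G0 V0 WG WV V1.
have jp := joint_pmf hp lift_kernelP.
rewrite -(Ex_lift G0); apply: (centropy_code jp (W := fun a i => W a (letter i))).
- by move=> *; exact: W0.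
- by move=> *; exact: G0.
- move=> [u i]; rewrite /joint/= => pq.
  have pu : 0 < p u by rewrite lt0r p0 andbT; apply: contraTneq pq => ->; rewrite mul0r ltxx.
  by apply: WG => //; apply: lift_gt0; rewrite pmulr_rgt0 in pq.
- pose VY i := V (letter i).
  apply: (@le_trans _ _ (Ex (joint p (lift_kernel k)) (fun w => VY w.2))).
    rewrite (@Ex_dist _ _ _ jp _ Y VY)//; last by move=> i; exact: V0.
    apply: le_esum => i _; under eq_esum do rewrite mulrC EFinM.
    rewrite esumZl ?(dist_ge0 jp)//; last by move=> a; rewrite lee_fin.
    by rewrite EFinM lee_wpmul2l// lee_fin (dist_ge0 jp).
  rewrite (@Ex_lift (fun _ y => V y))//.
  rewrite (_ : esum _ _ = (\sum_y (mu y * V y)%:E)%E) ?sumEFin ?lee_fin//.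
  transitivity (\esum_(u in [set: Om]) (\sum_y ((V y)%:E * (p u * k u y)%:E))%E).
    apply: eq_esum => u _; rewrite mulr_sumr -sumEFin; apply: eq_bigr => y _.
    by rewrite -EFinM; congr EFin; ring.
  rewrite esum_sum; last by move=> u y _ _; rewrite lee_fin !mulr_ge0.
  rewrite -sumEFin; apply: eq_bigr => y _; rewrite esumZl//; last first.
    by move=> u; rewrite lee_fin mulr_ge0.
  by rewrite muE -EFinM mulrC.
Qed.

Lemma marginal_of_indep (A : choiceType) (f : Om -> A) (g : Om -> R) (m : R) :
  (forall u, 0 <= g u) -> 0 <= m ->
  (forall a, \esum_(u in [set u | f u = a]) (p u * g u)%:E = (dist p f a * m)%:E) ->
  \esum_(u in [set: Om]) (p u * g u)%:E = m%:E.
Proof.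
move=> g0 m0 ind; rewrite (esum_fiber f); last by move=> u; rewrite lee_fin mulr_ge0.
under eq_esum do rewrite setTI ind mulrC EFinM.
by rewrite esumZl ?(esum_dist hp) ?mule1// => a; rewrite lee_fin (dist_ge0 hp).
Qed.

Lemma entropy_indep (A : choiceType) (f : Om -> A) (mu : L -> R) :
  (forall y, 0 <= mu y) ->
  (forall a y, \esum_(u in [set u | f u = a]) (p u * k u y)%:E =
     (dist p f a * mu y)%:E) ->
  centropy (joint p (lift_kernel k)) (fun w => f w.1) Y = entropy p f.
Proof.
move=> mu0 ind; have jp := joint_pmf hp lift_kernelP.
pose nu i := \sum_(y | pickle y == i) mu y.
have nu0 i : 0 <= nu i by exact: sumr_ge0.
have q0 u i : 0 <= lift_kernel k u i by exact: sumr_ge0.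
have indq a i : \esum_(u in [set u | f u = a]) (p u * lift_kernel k u i)%:E =
    (dist p f a * nu i)%:E.
  transitivity (\esum_(u in [set u | f u = a])
      (\sum_(y | pickle y == i) (p u * k u y)%:E)%E).
    by apply: eq_esum => u _; rewrite /lift_kernel mulr_sumr sumEFin.
  rewrite esum_sum; last by move=> u y _ _; rewrite lee_fin !mulr_ge0.
  by rewrite /nu mulr_sumr -sumEFin; apply: eq_bigr => y _; rewrite ind.
have distYE i : dist (joint p (lift_kernel k)) Y i = nu i.
  rewrite dist_Y; last exact: lift_kernelP.
  by rewrite (marginal_of_indep (q0^~ i) (nu0 i) (indq^~ i)).
rewrite -(entropy_joint hp f lift_kernelP) (entropyE jp) (centropyE jp).
apply: (eq_Ex jp) => w Pw; congr (- log2 _).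
have Yw := dist_gt0 jp Y Pw; move: Yw; rewrite distYE => Yw.
rewrite dist_jointY; last exact: lift_kernelP.
rewrite indq/= (dist_joint hp f _ lift_kernelP) mulfK//.
by rewrite gt_eqF.
Qed.

End Lift.

(** * Truncation of countable alphabets *)

Section Truncation.
Context {R : realType} {Om : choiceType} (P : Om -> R) (hP : is_pmf P).

(** A finite set of points carries the expectation up to [e], and [h] is bounded on it. *)
Lemma Ex_tail (F : Om -> R) (h : Om -> nat) (e : R) :
  (forall w, 0 <= F w) -> Ex P F \is a fin_num -> 0 < e ->
  exists n, (Ex P (fun w => if (n <= h w)%N then F w else 0%R) <= e%:E)%E.
Proof.
move=> F0 finF e0; have P0 := hP.1.
have [_ [/= D [finD _] <-] hD] := ub_ereal_sup_adherent e0 finF.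
have /finite_seqP[s sE] := finD; pose n := (\max_(w <- s) h w).+1; exists n.
have hn w : w \in D -> (h w < n)%N.
  by rewrite inE sE/= ltnS => ws; exact: (@leq_bigmax_seq _ s xpredT h).
have split_ : Ex P F = (Ex P (fun w => if (n <= h w)%N then 0%R else F w) +
    Ex P (fun w => if (n <= h w)%N then F w else 0%R))%E.
  rewrite -(ExD hP); [|by move=> w; case: ifP..].
  by apply: (eq_Ex hP) => w _; case: ifP; rewrite ?addr0 ?add0r.
have head : (\sum_(w \in D) (P w * F w)%:E <=
    Ex P (fun w => if (n <= h w)%N then 0%R else F w))%E.
  apply: esum_ge; exists D; first by split.
  rewrite le_eqVlt; apply/orP; left; apply/eqP; apply: eq_fsbigr => w wD.
  by rewrite leqNgt hn.
move: finF; rewrite split_ fin_numD => /andP[/fineK HE /fineK TE].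
have := lt_le_trans hD head; rewrite -[ereal_sup _]/(Ex P F) split_ -HE -TE.
by rewrite -!EFinD lte_fin lee_fin; lra.
Qed.

Context {T : countType} (n : nat).

Definition trunc (t : T) : 'I_n.+1 := inord (minn (pickle t) n).

(* Factor by which the weight of [trunc t] has to be multiplied to describe [t]. *)
Definition tail_wt (f : Om -> T) (t : T) : R :=
  if (pickle t < n)%N then 1 else dist P f t.

Lemma trunc_val t : trunc t = minn (pickle t) n :> nat.
Proof. by rewrite /trunc inordK// ltnS geq_minr. Qed.

Lemma tail_wt_ge0 f t : 0 <= tail_wt f t.
Proof. by rewrite /tail_wt; case: ifP => // _; exact: (dist_ge0 hP). Qed.

(** A class below [n] contains at most one value, of weight 1; the last class is weighted by the law
    of [f] itself. *)
Lemma tail_wt_sum f b :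
  (\esum_(t in [set: T]) (if trunc t == b then tail_wt f t else 0%R)%:E <= 1)%E.
Proof.
have [[t0 /andP[tn /eqP tb]]|nex] :=
  pselect (exists t, (pickle t < n)%N && (trunc t == b)).
- rewrite (esumID [set t0]); last first.
    by move=> t _; rewrite lee_fin; case: ifP => // _; exact: tail_wt_ge0.
  rewrite setTI esum_set1 ?tb ?eqxx; last by rewrite lee_fin; exact: tail_wt_ge0.
  rewrite /tail_wt tn esum1 ?adde0// => t [_ /= tt0].
  case: eqP => // tb'; exfalso; apply: tt0; apply: (pcan_inj pickleK).
  have := congr1 val (etrans tb' (esym tb)); rewrite /= !trunc_val.
  by rewrite (minn_idPl (ltnW tn)) /minn; case: ltnP => // _ nn; rewrite -nn ltnn in tn.
- rewrite -(esum_dist hP f); apply: le_esum => t _; rewrite lee_fin.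
  case: eqP => [tb|_]; last exact: (dist_ge0 hP).
  rewrite /tail_wt; case: ltnP => // tn; exfalso; apply: nex.
  by exists t; rewrite tn tb eqxx.
Qed.

End Truncation.

(** * Kernels obtained from couplings *)

Section Conditional.
Context {R : realType} {Om A : choiceType} {B L : finType} (p : Om -> R).
Context (hp : is_pmf p) (f : Om -> A) (g : Om -> B) (y0 : L).
Context (phi : A -> B -> L -> R) (mu : L -> R).

Definition cond_dist (a : A) (b : B) : R :=
  dist p (fun u => (f u, g u)) (a, b) / dist p f a.

(** [phi a] is a joint law of [g] and the letter given [f = a], and this is the resulting
    conditional law of the letter. The point mass at [y0] fills in null events. *)
Definition cond_kernel (u : Om) (y : L) : R :=
  if cond_dist (f u) (g u) == 0 then (y == y0)%:R
  else phi (f u) (g u) y / cond_dist (f u) (g u).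

Lemma cond_dist_ge0 a b : 0 <= cond_dist a b.
Proof. by rewrite divr_ge0 ?(dist_ge0 hp). Qed.

Lemma cond_dist_gt0 u : 0 < p u -> 0 < cond_dist (f u) (g u).
Proof.
by move=> pu; rewrite divr_gt0 ?(dist_gt0 hp) ?(dist_gt0 hp (fun u => (f u, g u))).
Qed.

Lemma dist_pair_fin a :
  \sum_b dist p (fun u => (f u, g u)) (a, b) = dist p f a.
Proof.
apply: EFin_inj; rewrite -sumEFin -(dist_pair hp g f a) esum_fin.
  by apply: eq_bigr => b _; rewrite dist_swap.
by move=> b; rewrite lee_fin (dist_ge0 hp).
Qed.

Lemma cond_dist_sum a : 0 < dist p f a -> \sum_b cond_dist a b = 1.
Proof. by move=> a0; rewrite -mulr_suml dist_pair_fin divff// gt_eqF. Qed.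

Hypothesis phi0 : forall a b y, 0 < dist p f a -> 0 <= phi a b y.
Hypothesis phi_sum : forall a b, 0 < dist p f a ->
  \sum_y phi a b y = cond_dist a b.
Hypothesis phi_marginal : forall a y, 0 < dist p f a ->
  \sum_b phi a b y = mu y.

Let cond_dist_neq0 a b : cond_dist a b != 0 -> 0 < dist p f a.
Proof.
move=> ab; rewrite lt0r (dist_ge0 hp) andbT; apply: contraNneq ab.
by rewrite /cond_dist => ->; rewrite invr0 mulr0.
Qed.

Lemma cond_kernel_ge0 u y : 0 <= cond_kernel u y.
Proof.
rewrite /cond_kernel; case: ifPn => // /cond_dist_neq0 a0.
by rewrite divr_ge0 ?phi0// cond_dist_ge0.
Qed.

Lemma cond_kernel_sum u : \sum_y cond_kernel u y = 1.
Proof.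
rewrite /cond_kernel; case: (boolP (cond_dist (f u) (g u) == 0)) => [_|ab].
  by rewrite (bigD1 y0)//= eqxx big1 ?addr0// => y /negbTE ->.
by rewrite -mulr_suml phi_sum ?divff//; exact: (cond_dist_neq0 ab).
Qed.

Lemma cond_kernelE u y : 0 < p u ->
  cond_kernel u y = phi (f u) (g u) y / cond_dist (f u) (g u).
Proof. by move=> /cond_dist_gt0 ab; rewrite /cond_kernel gt_eqF. Qed.

(** Averaging over [g] given [f = a] undoes the division and leaves the letter marginal of [phi a],
    which is [mu] for every [a] of positive mass. *)
Lemma cond_kernel_indep a y :
  \esum_(u in [set u | f u = a]) (p u * cond_kernel u y)%:E =
  (dist p f a * mu y)%:E.
Proof.
have p0 := hp.1; have [a0|a0] := eqVneq (dist p f a) 0.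
  rewrite a0 mul0r esum1// => u /= fa; apply/eqP; rewrite eqe mulf_eq0.
  apply/orP; left; rewrite eq_le p0 andbT leNgt; apply/negP => pu.
  by have := dist_gt0 hp f pu; rewrite fa a0 ltxx.
have {}a0 : 0 < dist p f a by rewrite lt0r a0 (dist_ge0 hp).
rewrite (esum_fiber g); last by move=> u; rewrite lee_fin mulr_ge0// cond_kernel_ge0.
pose c b := if cond_dist a b == 0 then (y == y0)%:R else phi a b y / cond_dist a b.
have c0 b : 0 <= c b.
  by rewrite /c; case: ifP => // _; rewrite divr_ge0 ?phi0// cond_dist_ge0.
transitivity (\esum_(b in [set: B]) (c b * dist p (fun u => (f u, g u)) (a, b))%:E).
  apply: eq_esum => b _; rewrite EFinM (distE hp) -esumZl//.
  have -> : [set u | f u = a] `&` [set u | g u = b] = [set u | (f u, g u) = (a, b)].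
    by apply/seteqP; split=> u /=; [move=> [-> ->]|move=> [-> ->]].
  apply: eq_esum => u /= [fu gu]; rewrite /cond_kernel fu gu -EFinM mulrC.
  by [].
rewrite esum_fin; last by move=> b; rewrite lee_fin mulr_ge0// (dist_ge0 hp).
rewrite sumEFin -(phi_marginal _ a0) mulr_sumr; congr EFin; apply: eq_bigr => b _.
have -> : dist p (fun u => (f u, g u)) (a, b) = cond_dist a b * dist p f a.
  by rewrite divfK// gt_eqF.
rewrite /c; case: ifPn => ab; last by rewrite mulrA divfK// mulrC.
(* On a null event the nonnegative numbers [phi a b _] sum to 0, so the default letter of the kernel
   does no harm. *)
have -> : phi a b y = 0.
  have /eqP := phi_sum b a0; rewrite (eqP ab) psumr_eq0; last first.
    by move=> z _; exact: phi0.
  by move=> /allP/(_ y); rewrite mem_index_enum => /(_ isT)/eqP.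
by rewrite (eqP ab) mul0r !mulr0.
Qed.

End Conditional.

(** * Independent copies *)

Section Copies.
Context {R : realType}.

Context {S : finType} {X T A : countType}.
Context {p : S * X * T -> R} (hp : is_pmf p).
Local Notation Om := (S * X * T)%type.
Local Notation Y := (@yY S X T).
Local Notation rT := (@rvT S X T).
Context {f : Om -> A}.

Let p0 u : 0 <= p u. Proof. exact: hp.1. Qed.

(** A decoder guesses the position of [f] according to its law, so describing [T] costs at most the
    self-information of [f]; the two tail terms pay for values beyond [n] and [N]. *)
Lemma copies_bound (n N : nat) : exists2 q, is_kernel q &
  centropy (joint p q) (fun w => f w.1) Y = entropy p f /\
  (centropy (joint p q) (fun w => rT w.1) Y <=
   Ex p (self_info p f) +
   (Ex p (fun u => if (n <= pickle (rT u))%N then self_info p rT u else 0%R) +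
    Ex p (fun u => if (N <= pickle (f u))%N then self_info p rT u else 0%R)))%E.
Proof.
pose g u := trunc n (rT u).
pose cd := cond_dist p f g.
pose L := {ffun 'I_N.+1 -> 'I_n.+1}.
(* Law of the truncated [T] given the value of [f] with code [i]; a point mass where there is no
   such value or it has mass 0. *)
pose row (i : nat) (b : 'I_n.+1) : R :=
  if unpickle i is Some a then if dist p f a == 0 then (b == ord0)%:R else cd a b
  else (b == ord0)%:R.
have delta1 : \sum_(b < n.+1) (b == ord0)%:R = 1 :> R.
  by rewrite (bigD1 ord0)//= big1 ?addr0// => b /negbTE ->.
have row0 i b : 0 <= row i b.
  rewrite /row; case: unpickle => // a; case: ifP => // _.
  exact: (cond_dist_ge0 hp).
have row1 i : \sum_b row i b = 1.
  rewrite /row; case: unpickle => // a.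
  case: (boolP (dist p f a == 0)) => // a0.
  by apply: (cond_dist_sum hp); rewrite lt0r a0 (dist_ge0 hp).
have rowE a b : 0 < dist p f a -> row (pickle a) b = cd a b.
  by move=> a0; rewrite /row pickleK gt_eqF.
pose mu (y : L) : R := \prod_(i < N.+1) row i (y i).
have mu0 y : 0 <= mu y by exact: prodr_ge0.
(* The truncated [T] is read off at row [a] if [a] has code below [N], and is drawn independently of
   the codebook otherwise. *)
pose phi a b (y : L) : R :=
  mu y * (if (pickle a < N)%N then (y (trunc N a) == b)%:R else cd a b).
have phi0 a b y : 0 < dist p f a -> 0 <= phi a b y.
  move=> _; rewrite mulr_ge0//; case: ifP => // _; exact: (cond_dist_ge0 hp).
have phi_sum a b : 0 < dist p f a -> \sum_y phi a b y = cd a b.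
  move=> a0; rewrite /phi; case: (boolP (pickle a < N)%N) => aN.
    rewrite (@prod_marginal _ _ _ (fun (i : 'I_N.+1) b => row i b) (fun j => (j == b)%:R))//.
    rewrite (bigD1 b)//= eqxx mulr1 big1 ?addr0; last first.
      by move=> j /negbTE ->; rewrite mulr0.
    by rewrite trunc_val (minn_idPl (ltnW aN)) rowE.
  by rewrite -mulr_suml (@prod_total _ _ _ (fun (i : 'I_N.+1) b => row i b))// mul1r.
have phi_marg a y : 0 < dist p f a -> \sum_b phi a b y = mu y.
  move=> a0; rewrite -mulr_sumr; case: (boolP (pickle a < N)%N) => aN.
    rewrite (bigD1 (y (trunc N a)))//= eqxx big1 ?addr0 ?mulr1// => b.
    by rewrite eq_sym => /negbTE ->.
  by rewrite (cond_dist_sum hp)// mulr1.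
pose y0 : L := [ffun=> ord0].
pose k := cond_kernel p f g y0 phi.
have k0 := cond_kernel_ge0 hp g y0 phi0.
have k1 := cond_kernel_sum hp y0 phi_sum.
have ind := cond_kernel_indep hp y0 phi0 phi_sum phi_marg.
exists (lift_kernel k); first exact: (lift_kernelP k0 k1).
split; first exact: (entropy_indep hp k0 k1 mu0 ind).
pose pi i := dist p (fun u => trunc N (f u)) i.
have pi0 i : 0 <= pi i by exact: (dist_ge0 hp).
have pi1 : \sum_i pi i = 1.
  apply: EFin_inj; rewrite -sumEFin -(esum_dist hp (fun u => trunc N (f u))) esum_fin//.
(* Decoder for position [i]: the row gives [T] up to its tail; the last position falls back on the
   unconditional law of [T]. *)
pose w (i : 'I_N.+1) (t : T) (y : L) : R :=
  if (i < N)%N then (if trunc n t == y i then tail_wt p n rT t else 0) else dist p rT t.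
have w0 i t y : 0 <= w i t y.
  rewrite /w; case: ifP => _; last exact: (dist_ge0 hp).
  by case: ifP => // _; exact: (tail_wt_ge0 hp).
pose W t y := \sum_i pi i * w i t y.
pose G u (_ : L) := self_info p f u +
  ((if (n <= pickle (rT u))%N then self_info p rT u else 0) +
   (if (N <= pickle (f u))%N then self_info p rT u else 0)).
have G0 u y : 0 <= G u y.
  by rewrite /G; case: ifP => _; case: ifP => _; rewrite ?addr0 ?addr_ge0// (self_info_ge0 hp).
have muE := fun y => marginal_of_indep hp (k0^~ y) (mu0 y) (ind^~ y).
have w_sum i y : (\esum_(t in [set: T]) (w i t y)%:E <= 1)%E.
  rewrite /w; case: (boolP (i < N)%N) => _; last by rewrite (esum_dist hp).
  exact: (tail_wt_sum hp).
have WV y : (\esum_(t in [set: T]) (W t y)%:E <= 1%:E)%E.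
  rewrite /W; under eq_esum do rewrite -sumEFin.
  rewrite esum_sum; last by move=> t i _ _; rewrite lee_fin mulr_ge0.
  rewrite -pi1 -sumEFin; apply: lee_sum => i _.
  under eq_esum do rewrite EFinM.
  rewrite esumZl//; last by move=> t; rewrite lee_fin.
  by rewrite -[leRHS]mule1; apply: lee_wpmul2l; [rewrite lee_fin|exact: w_sum].
have WG u y : 0 < p u -> 0 < k u y ->
    0 < W (rT u) y /\ - log2 (W (rT u) y) <= G u y + 0.
  move=> pu kuy; have fu := dist_gt0 hp f pu; have Tu := dist_gt0 hp rT pu.
  set i0 := trunc N (f u).
  have pi_i0 : dist p f (f u) <= pi i0 by apply: (dist_comp_le hp) => v ->.
  have Wge : dist p f (f u) * w i0 (rT u) y <= W (rT u) y.
    rewrite /W (bigD1 i0)//= -[leLHS]addr0 lerD ?ler_wpM2r// sumr_ge0// => i _.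
    by rewrite mulr_ge0.
  have [wi Gi] : 0 < w i0 (rT u) y /\ - log2 (w i0 (rT u) y) <=
      (if (n <= pickle (rT u))%N then self_info p rT u else 0) +
      (if (N <= pickle (f u))%N then self_info p rT u else 0).
    move: kuy; rewrite /k (cond_kernelE hp)// pmulr_lgt0 ?invr_gt0; last first.
      exact: (cond_dist_gt0 hp).
    rewrite /w /i0 trunc_val gtn_min ltnn orbF /phi; case: ltnP => fN.
      case: eqP => [yi _|_]; last by rewrite mulr0 ltxx.
      rewrite -/i0 yi eqxx /tail_wt addr0; case: ltnP => _; last by [].
      by rewrite ltr01 /log2 ln1 mul0r oppr0.
    by move=> _; split=> //; rewrite lerDr; case: ifP => // _; exact: (self_info_ge0 hp).
  split; first by rewrite (lt_le_trans _ Wge)// mulr_gt0.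
  rewrite addr0 /G; apply: (@le_trans _ _ (- log2 (dist p f (f u) * w i0 (rT u) y))).
    by rewrite lerN2 ler_log2// mulr_gt0.
  by rewrite log2M// opprD lerD.
have code := @centropy_lift _ _ _ _ _ hp _ y0 _ k0 k1 _ rT mu W (fun=> 1) G 0 muE.
rewrite adde0 in code; apply: le_trans (code _ G0 _ WG WV _) _ => //.
- by move=> t y; apply: sumr_ge0 => i _; rewrite mulr_ge0.
- under eq_bigr do rewrite mulr1.
  by rewrite (@prod_total _ _ _ (fun (i : 'I_N.+1) b => row i b)).
rewrite -(ExD hp); last 2 first.
- by move=> u; case: ifP => // _; exact: (self_info_ge0 hp).
- by move=> u; case: ifP => // _; exact: (self_info_ge0 hp).
rewrite -(ExD hp); last 2 first.
- exact: (self_info_ge0 hp).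
- by move=> u; apply: addr_ge0; case: ifP => // _; exact: (self_info_ge0 hp).
apply: le_esum => u _; rewrite lee_fin ler_wpM2l//.
by rewrite /G -mulr_suml k1 mul1r.
Qed.

(* Functional representation: [Y] stores independent samples of [T] given
   [f = a], for finitely many [a], so that [T] is read off at position [f]. *)
Lemma independent_copies (e : R) :
  entropy p f \is a fin_num -> entropy p rT \is a fin_num -> 0 < e ->
  exists2 q, is_kernel q &
  centropy (joint p q) (fun w => f w.1) Y = entropy p f /\
  (centropy (joint p q) (fun w => rT w.1) Y <= entropy p f + e%:E)%E.
Proof.
move=> fF fT e0; have e20 : 0 < e / 2 by rewrite divr_gt0.
rewrite (entropyE hp) in fT.
have [n hn] := Ex_tail hp (pickle \o rT) (self_info_ge0 hp rT) fT e20.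
have [N hN] := Ex_tail hp (pickle \o f) (self_info_ge0 hp rT) fT e20.
have [q qk [q1 q2]] := copies_bound n N; exists q => //; split=> //.
apply: (le_trans q2); rewrite (entropyE hp) leeD2l//.
by rewrite [e]splitr EFinD leeD.
Qed.

End Copies.

(** * The code attached to the race *)

Section Numerics.
Context {R : realType}.
Implicit Types (x b delta sigma : R).

Lemma ln3_le : ln 3 <= 8 / 5 * ln 2 :> R.
Proof.
have : ln (3 ^+ 5) <= ln (2 ^+ 8) :> R by rewrite ler_ln ?posrE; lra.
by rewrite !lnXn// -[ln 3 *+ 5]mulr_natr -[ln 2 *+ 8]mulr_natr; lra.
Qed.

(* That is, [27/25 * e * ln 2 <= 2 `^ (106/100)]. *)
Lemma ln_const_le : ln (27 / 25) + 1 + ln (ln 2) <= 106 / 100 * ln 2 :> R.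
Proof.
have l2 := @ln2_gt0 R; have l3 := ln3_le.
(* [27 / 25 = 3 / 4 * (144 / 100)], and [144 / 100 * ln 2] is close to 1, where [ln x <= x - 1] is
   sharp. *)
have e1 : ln (27 / 25) + ln (ln 2) = ln (3 / 2 ^+ 2) + ln (144 / 100 * ln 2) :> R.
  rewrite -!lnM ?posrE ?mulr_gt0//; try lra.
  by congr ln; field.
have e2 : ln (3 / 2 ^+ 2) = ln 3 - 2 * ln 2 :> R.
  by rewrite ln_div ?posrE// lnXn// mulr_natl.
have e3 : ln (144 / 100 * ln 2) <= 144 / 100 * ln 2 - 1 :> R.
  have := @le_ln1Dx R (144 / 100 * ln 2 - 1).
  have -> : 1 + (144 / 100 * ln 2 - 1) = 144 / 100 * ln 2 :> R by ring.
  by apply; lra.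
by lra.
Qed.

(* [(x + log2 27) * ln 2] is the optimal decay parameter [lam] in [race_bound]. *)
Lemma redundancy_le x : 0 <= x ->
  (1 + ((x + log2 27) * ln 2)^-1) * (x + log2 27) +
    log2 (25^-1 * ((x + log2 27) * ln 2)) <=
  x + log2 (x + 551 / 100) + 106 / 100.
Proof.
move=> x0; have l2 := @ln2_gt0 R.
have l27 : 0 < log2 27 :> R by rewrite /log2 divr_gt0// ln_gt0//; lra.
have l27' : log2 27 <= 5 :> R.
  have : log2 27 <= log2 (2 ^+ 5) :> R by apply: ler_log2; lra.
  by rewrite [X in _ <= X]/log2 lnXn// -[ln 2 *+ 5]mulr_natl mulfK ?gt_eqF.
set z := x + log2 27; have z0 : 0 < z by rewrite /z; lra.
have -> : (1 + (z * ln 2)^-1) * z = z + (ln 2)^-1.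
  by field; rewrite !gt_eqF.
have -> : log2 (25^-1 * (z * ln 2)) = log2 z + (log2 (ln 2) - log2 25).
  by rewrite !log2M ?mulr_gt0// log2V//; ring.
have zl : log2 z <= log2 (x + 551 / 100) by apply: ler_log2 => //; rewrite /z; lra.
have c : log2 27 - log2 25 + (ln 2)^-1 + log2 (ln 2) <= 106 / 100 :> R.
  rewrite -log2_div// [X in X <= _](_ : _ = (ln (27 / 25) + 1 + ln (ln 2)) / ln 2).
    by rewrite ler_pdivrMr// ln_const_le.
  by rewrite /log2; ring.
by rewrite {1}/z; lra.
Qed.

Lemma powR_integral_step sigma delta x : 0 < sigma -> 0 < delta -> 0 < x ->
  delta * (x + delta) `^ (- (1 + sigma)) <=
  sigma^-1 * (x `^ (- sigma) - (x + delta) `^ (- sigma)).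
Proof.
move=> s0 d0 x0; have y0 : 0 < x + delta by rewrite addr_gt0.
set y := x + delta; set w := y `^ (- sigma).
have w0 : 0 < w by exact: powR_gt0.
have -> : y `^ (- (1 + sigma)) = w / y.
  rewrite opprD addrC powRB; first by rewrite powRr1// ltW.
  by rewrite (gt_eqF y0) implybT.
have lnyx : delta / y <= ln y - ln x.
  have xy0 : 0 < x / y by rewrite divr_gt0.
  have /le_ln1Dx : -1 < x / y - 1 by lra.
  have -> : 1 + (x / y - 1) = x / y by ring.
  have -> : x / y - 1 = - (delta / y) by rewrite /y; field; rewrite gt_eqF.
  by rewrite ln_div ?posrE//; lra.
have wx : w * (1 + sigma * (ln y - ln x)) <= x `^ (- sigma).
  have -> : x `^ (- sigma) = w * expR (sigma * (ln y - ln x)).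
    by rewrite /w /powR !gt_eqF// -expRD; congr expR; ring.
  by rewrite ler_pM2l// expR_ge1Dx.
rewrite ler_pdivlMl// (le_trans _ (lerB wx (lexx w)))//.
have -> : w * (1 + sigma * (ln y - ln x)) - w = sigma * w * (ln y - ln x) by ring.
have -> : sigma * (delta * (w / y)) = sigma * w * (delta / y) by ring.
by rewrite ler_pM2l// mulr_gt0.
Qed.

Lemma powR_sum_le sigma delta b n : 0 < sigma -> 0 < delta -> 0 < b ->
  delta * (\sum_(j < n) (b + delta * j.+1%:R) `^ (- (1 + sigma))) <=
  sigma^-1 * b `^ (- sigma).
Proof.
move=> s0 d0 b0.
suff H : delta * (\sum_(j < n) (b + delta * j.+1%:R) `^ (- (1 + sigma))) <=
    sigma^-1 * (b `^ (- sigma) - (b + delta * n%:R) `^ (- sigma)).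
  apply: (le_trans H); rewrite ler_wpM2l ?invr_ge0 ?(ltW s0)//.
  by rewrite gerBl powR_ge0.
elim: n => [|n IH]; first by rewrite big_ord0 !mulr0 addr0 subrr mulr0.
rewrite big_ord_recr/= mulrDr.
have x0 : 0 < b + delta * n%:R by rewrite ltr_wpDr// mulr_ge0// (ltW d0).
have := powR_integral_step s0 d0 x0.
have -> : b + delta * n%:R + delta = b + delta * n.+1%:R by rewrite -natr1; ring.
by move: IH; lra.
Qed.

(** Jensen's inequality, from the tangent of [log2] at the mean [m]. *)
Lemma log2_concave (L : finType) (k z : L -> R) :
  (forall y, 0 <= k y) -> \sum_y k y = 1 -> (forall y, 0 < z y) ->
  \sum_y k y * log2 (z y) <= log2 (\sum_y k y * z y).
Proof.
move=> k0 k1 z0; set m := \sum_y _ * z _.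
have m0 : 0 < m.
  rewrite lt0r sumr_ge0 ?andbT => [|y _]; last by rewrite mulr_ge0// ltW.
  apply/negP => /eqP m_eq0; have := oner_neq0 R; rewrite -k1 big1 ?eqxx// => y _.
  have kz0 i : true -> 0 <= k i * z i by move=> _; rewrite mulr_ge0// ltW.
  have /eqP := psumr_eq0P kz0 m_eq0 (i := y) isT.
  by rewrite mulf_eq0 (gt_eqF (z0 y)) orbF => /eqP.
have tan y : log2 (z y) <= log2 m + (ln 2)^-1 * (z y / m - 1).
  have := log2_le_tangent (divr_gt0 (z0 y) m0); rewrite log2_div//; lra.
apply: (@le_trans _ _ (\sum_y k y * (log2 m + (ln 2)^-1 * (z y / m - 1)))).
  by apply: ler_sum => y _; rewrite ler_wpM2l.
have -> : \sum_y k y * (log2 m + (ln 2)^-1 * (z y / m - 1)) =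
    \sum_y (k y * (log2 m - (ln 2)^-1) + (k y * z y) * ((ln 2)^-1 / m)).
  by apply: eq_bigr => y _; ring.
rewrite big_split/= -!mulr_suml k1 -/m le_eqVlt; apply/orP; left; apply/eqP.
by field; rewrite !gt_eqF// ln2_gt0.
Qed.

End Numerics.

(** * Describing the winner of the race *)

Section RaceCode.
Context {R : realType}.

(** Supplies the hypothesis of [cell1_le] for all values of positive mass at once. *)
Lemma exists_levels n (Q : 'I_n -> R) (delta : R) : 0 < delta ->
  exists K : nat, forall t, 0 < Q t -> 1 <= Q t * delta * K.+1%:R.
Proof.
move=> d0; exists (\max_(t < n) Num.bound (Q t * delta)^-1)%N => t Qt.
have qd : 0 < Q t * delta by rewrite mulr_gt0.
rewrite -ler_pdivrMl// mulr1 ltW// (lt_le_trans (archi_boundP _)) ?invr_ge0 ?(ltW qd)//.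
rewrite ler_nat leqW//.
exact: (@leq_bigmax_cond _ xpredT (fun t : 'I_n => Num.bound (Q t * delta)^-1)).
Qed.

(** Makes the last term of [race_moment] cost no more than one extra mesh. Proved by Bernoulli's
    inequality. *)
Lemma exists_stages (K : nat) (eta : R) : 0 < eta < 1 ->
  exists M : nat, K%:R * (1 - eta) ^+ M <= 1.
Proof.
move=> /andP[e0 e1]; exists (Num.bound (K%:R / eta)); set M := Num.bound _.
have KM : K%:R / eta < M%:R by apply: archi_boundP; rewrite divr_ge0// ltW.
have e1' : 0 <= 1 - eta by lra.
have bern m : (1 + m%:R * eta) * (1 - eta) ^+ m <= 1.
  elim: m => [|m IH]; first by rewrite expr0; lra.
  have x0 : 0 <= (1 - eta) ^+ m by rewrite exprn_ge0.
  have : 0 <= (m%:R + 1) * (eta * eta) * (1 - eta) ^+ m.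
    by rewrite !mulr_ge0// ltW.
  by rewrite exprS -natr1; lra.
apply: le_trans (bern M); rewrite ler_wpM2r ?exprn_ge0//.
by move: KM; rewrite ltr_pdivrMr//; lra.
Qed.

Context {S : finType} {X T A : countType}.
Context {p : S * X * T -> R} (hp : is_pmf p).
Local Notation Om := (S * X * T)%type.
Local Notation Y := (@yY S X T).
Local Notation rT := (@rvT S X T).
Context {f : Om -> A}.

Let p0 u : 0 <= p u. Proof. exact: hp.1. Qed.

(** [E] is the mean of [log2 (B / bb)] for the shifted clock [B] of the true value. Gibbs'
    inequality bounds [E] by the mutual information plus [log2 27], and a power law code turns [E]
    into a description length. *)
Lemma race_bound (n : nat) (lam : R) : 0 < lam ->
  exists2 q, is_kernel q &
  centropy (joint p q) (fun w => f w.1) Y = entropy p f /\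
  exists2 E : \bar R,
    (E + centropy p rT f <= entropy p rT + (log2 27)%:E)%E /\ (0 <= E)%E &
    (centropy (joint p q) (fun w => rT w.1) Y <=
     Ex p (fun u => if (n <= pickle (rT u))%N then self_info p rT u else 0%R) +
     (1 + lam^-1)%:E * E + (log2 (25^-1 * lam))%:E)%E.
Proof.
move=> lam0.
pose g u := trunc n (rT u).
pose cd := cond_dist p f g.
pose Q b := dist p g b.
have Q0 b : 0 <= Q b by exact: (dist_ge0 hp).
(* Chosen so that [bb + 2 * delta + 1 / (1 - eta) <= 27 / 25]; dividing by [bb = 1 / 25] produces
   the 27 of the statement. *)
pose eta : R := 100^-1; pose delta : R := 100^-1; pose bb : R := 25^-1.
have eta01 : 0 < eta < 1 by rewrite /eta; lra.
have delta0 : 0 < delta by rewrite /delta; lra.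
have bb0 : 0 < bb by rewrite /bb; lra.
have [K KQ] := exists_levels Q delta0.
have [M KM] := exists_stages K eta01.
pose L := {ffun 'I_n.+1 -> 'I_K.+1}.
pose phi a b (y : L) : R := race (cd a) Q eta delta M b y.
pose mu (y : L) : R := \prod_(s < n.+1) cell Q delta K s (y s) 1.
have cd0 a b : 0 <= cd a b by exact: (cond_dist_ge0 hp).
have cd1 a : 0 < dist p f a -> \sum_b cd a b = 1 by exact: (cond_dist_sum hp).
have ordK (j : 'I_K.+1) : (j <= K)%N by rewrite -ltnS.
have mu0 y : 0 <= mu y by apply: prodr_ge0 => s _; exact: cell_ge0.
have phi0 a b y : 0 < dist p f a -> 0 <= phi a b y.
  by move=> a0; apply: race_ge0 => //; exact: cd1.
have phi_sum a b : 0 < dist p f a -> \sum_y phi a b y = cd a b.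
  by move=> a0; apply: race_sum => //; exact: cd1.
have phi_marg a y : 0 < dist p f a -> \sum_b phi a b y = mu y.
  by move=> a0; apply: race_marginal => //; exact: cd1.
pose y0 : L := [ffun=> ord0].
pose k := cond_kernel p f g y0 phi.
have k0 : forall u y, 0 <= k u y := cond_kernel_ge0 hp g y0 phi0.
have k1 : forall u, \sum_y k u y = 1 := cond_kernel_sum hp y0 phi_sum.
have ind := cond_kernel_indep hp y0 phi0 phi_sum phi_marg.
exists (lift_kernel k); first exact: (lift_kernelP k0 k1).
split; first exact: (entropy_indep hp k0 k1 mu0 ind).
(* The clock is moved up by one mesh for the integral comparison, and by [bb] to stay away from the
   singularity of the power at 0. *)
pose B (j : nat) : R := bb + delta * j.+1%:R.
have B0 j : bb <= B j by rewrite /B lerDl mulr_ge0// ltW.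
have Bgt0 j : 0 < B j by rewrite (lt_le_trans bb0).
have lB0 j : 0 <= log2 (B j / bb).
  by rewrite log2_ge0// ler_pdivlMr// mul1r.
pose sigma := lam^-1; have sigma0 : 0 < sigma by rewrite invr_gt0.
pose v j : R := B j `^ (- (1 + sigma)).
have v0 j : 0 < v j by exact: powR_gt0.
pose Z : R := lam * bb `^ (- sigma).
have Z0 : 0 < Z by rewrite mulr_gt0// powR_gt0.
have vZ m : delta * (\sum_(j < m) v j) <= Z.
  have := powR_sum_le m sigma0 delta0 bb0.
  by rewrite /Z -[lam]invrK.
(* One [delta] comes from the upward shift in [B], the other from the case where no stage has a
   winner. *)
pose c0 : R := bb + delta + delta.
pose h a b := c0 + cd a b / (Q b * (1 - eta)).
have eta1 : 0 < 1 - eta by rewrite /eta; lra.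
have c00 : 0 < c0 by rewrite /c0 /bb /delta; lra.
have h0 a b : 0 < h a b.
  by rewrite ltr_wpDr// divr_ge0// mulr_ge0// ltW.
have mean_B u : 0 < p u -> \sum_y k u y * B (y (g u)) <= h (f u) (g u).
  move=> pu; have a0 : 0 < dist p f (f u) := dist_gt0 hp f pu.
  have Qu : 0 < Q (g u) := dist_gt0 hp g pu.
  have cdu : 0 < cd (f u) (g u) := cond_dist_gt0 hp f g pu.
  have mom := @race_moment _ _ (cd (f u)) Q eta delta K M (cd0 _) (cd1 _ a0) Q0 eta01 delta0 (g u).
  set s := \sum_y _ * _ in mom.
  have -> : \sum_y k u y * B (y (g u)) = bb + delta + delta * s / cd (f u) (g u).
    rewrite -[X in X + _]mul1r -(k1 u) mulr_suml mulrAC mulr_sumr -big_split/=.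
    apply: eq_bigr => y _; rewrite /k (cond_kernelE hp)// -/cd /phi /B -natr1.
    by field; rewrite gt_eqF.
  rewrite /h /c0 -[leRHS]addrA lerD2l ler_pdivrMr// -(ler_pM2l Qu).
  have -> : Q (g u) * (delta * s) = Q (g u) * delta * s by ring.
  apply: (le_trans mom).
  have -> : Q (g u) * ((delta + cd (f u) (g u) / (Q (g u) * (1 - eta))) * cd (f u) (g u)) =
      cd (f u) (g u) * (cd (f u) (g u) / (1 - eta) + Q (g u) * delta * 1).
    by field; rewrite !gt_eqF.
  by rewrite ler_pM2l// lerD2l -!mulrA !ler_wpM2l// ltW.
pose lB u := \sum_y k u y * log2 (B (y (g u)) / bb).
have lB_ge0 u : 0 <= lB u by apply: sumr_ge0 => y _; rewrite mulr_ge0.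
have lB_le u : 0 < p u -> lB u <= log2 (h (f u) (g u) / bb).
  move=> pu; apply: (@le_trans _ _ (log2 (\sum_y k u y * (B (y (g u)) / bb)))).
    by apply: log2_concave => // y; rewrite divr_gt0.
  under eq_bigr do rewrite mulrA.
  rewrite -mulr_suml ler_log2//.
    rewrite divr_gt0// (lt_le_trans bb0)// -[leLHS]mul1r -(k1 u) mulr_suml.
    by apply: ler_sum => y _; rewrite ler_wpM2l.
  by rewrite ler_wpM2r ?mean_B// invr_ge0 ltW.
exists (Ex p lB).
  split; last exact: (Ex_ge0 hp).
  rewrite (centropyE hp) (entropyE hp).
  have l27 : 0 <= log2 27 :> R by rewrite log2_ge0//; lra.
  rewrite -(Ex_cst hp l27) -(ExD hp)//; last exact: (cond_info_ge0 hp).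
  rewrite -(ExD hp)//; last exact: (self_info_ge0 hp).
  pose Tf u := (rT u, f u).
  (* The product law of [T] and [f] is reweighted by [h], which contains the likelihood ratio of the
     truncated [T]; the mean of [h] is at most [c0 + 1 / (1 - eta) <= 27 / 25]. *)
  pose psi (ta : T * A) : R :=
    h ta.2 (trunc n ta.1) / (27 / 25) * (dist p rT ta.1 * dist p f ta.2).
  have psi0 ta : 0 <= psi ta.
    by rewrite !mulr_ge0 ?invr_ge0 ?(dist_ge0 hp) ?ltW//; lra.
  apply: (gibbs hp (D := fun u => psi (Tf u) / dist p Tf (Tf u))) => //.
  - by move=> u; rewrite addr_ge0// (cond_info_ge0 hp).
  - by move=> u; rewrite addr_ge0// (self_info_ge0 hp).
  - by move=> u; rewrite divr_ge0// (dist_ge0 hp).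
  - move=> u pu; have Tu := dist_gt0 hp rT pu; have fu := dist_gt0 hp f pu.
    have Tfu : 0 < dist p Tf (Tf u) := dist_gt0 hp Tf pu.
    have c25 : 0 < 25 :> R by lra.
    have c27 : 0 < 27 :> R by lra.
    have hC : 0 < h (f u) (trunc n (rT u)) / (27 / 25) by rewrite !divr_gt0.
    split; first by rewrite divr_gt0// !mulr_gt0.
    rewrite /psi/= -/(Tf u) !log2_div ?mulr_gt0 ?divr_gt0// !log2M ?log2_div ?mulr_gt0 ?divr_gt0//.
    have lC : log2 (27 / 25)^-1 = log2 25 - log2 27 :> R.
      by rewrite log2V ?divr_gt0// log2_div// opprB.
    have := lB_le u pu; rewrite log2_div// /bb log2V// lC.
    by rewrite -/Tf /g; lra.
  - rewrite (le_trans (Ex_density hp Tf psi0))// esum_prod// esum_swap; last first.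
      by move=> t a; rewrite lee_fin.
    rewrite -(esum_dist hp f); apply: le_esum => a _.
    have [a0|a0] := eqVneq (dist p f a) 0.
      by rewrite a0 esum1// => t _; rewrite /psi/= a0 !mulr0.
    have {}a0 : 0 < dist p f a by rewrite lt0r a0 (dist_ge0 hp).
    have h00 b : 0 <= h a b by exact: ltW.
    have -> : \esum_(t in [set: T]) (psi (t, a))%:E =
        ((dist p f a / (27 / 25))%:E * Ex p (fun u => h a (g u)))%E.
      rewrite (@Ex_dist _ _ _ hp _ rT (fun t => h a (trunc n t)))// -esumZl; last 2 first.
      - by rewrite divr_ge0// ?ltW//; lra.
      - by move=> t; rewrite lee_fin mulr_ge0// (dist_ge0 hp).
      by apply: eq_esum => t _; rewrite -EFinM /psi/=; congr EFin; ring.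
    rewrite (@Ex_dist _ _ _ hp _ g (h a))// esum_fin; last first.
      by move=> b; rewrite lee_fin mulr_ge0// (dist_ge0 hp).
    rewrite sumEFin -EFinM lee_fin mulrAC ler_pdivrMr; last lra.
    rewrite ler_pM2l//.
    apply: (@le_trans _ _ (\sum_b (Q b * c0 + cd a b / (1 - eta)))).
      apply: ler_sum => b _; rewrite /h mulrDr lerD2l -/(Q b).
      have [->|Qb] := eqVneq (Q b) 0; first by rewrite !mul0r divr_ge0// ltW.
      have -> : Q b * (cd a b / (Q b * (1 - eta))) = cd a b / (1 - eta).
        by field; rewrite Qb gt_eqF.
      by [].
    have -> : \sum_b (Q b * c0 + cd a b / (1 - eta)) =
        (\sum_b Q b) * c0 + (\sum_b cd a b) / (1 - eta).
      by rewrite !mulr_suml -big_split.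
    rewrite cd1//.
    have -> : \sum_b Q b = 1.
      by apply: EFin_inj; rewrite -sumEFin -(esum_dist hp g) esum_fin.
    by rewrite -lerBrDl ler_pdivrMr// /c0 /bb /delta /eta; lra.
have lam_log : log2 Z = log2 lam - sigma * log2 bb.
  by rewrite log2M ?powR_gt0// /log2 ln_powR; ring.
(* Code weights [B^-(1 + 1/lam)] of the rounded clock of [t]. *)
pose W t (y : L) : R := if 0 < Q (trunc n t)
  then tail_wt p n rT t * (v (y (trunc n t)) / Z) else 0.
have W0 t y : 0 <= W t y.
  rewrite /W; case: ifP => // _; rewrite mulr_ge0 ?(tail_wt_ge0 hp)//.
  by rewrite divr_ge0// ltW.
pose V (y : L) : R := \sum_b (if 0 < Q b then v (y b) / Z else 0).
have V0 y : 0 <= V y.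
  by apply: sumr_ge0 => b _; case: ifP => // _; rewrite divr_ge0// ltW.
have WV y : (\esum_(t in [set: T]) (W t y)%:E <= (V y)%:E)%E.
  pose c b : R := if 0 < Q b then v (y b) / Z else 0.
  have c_ge0 b : 0 <= c b by rewrite /c; case: ifP => // _; rewrite divr_ge0// ltW.
  pose w b t : R := if trunc n t == b then tail_wt p n rT t else 0.
  have w_ge0 b t : 0 <= w b t by rewrite /w; case: ifP => // _; exact: (tail_wt_ge0 hp).
  rewrite (eq_esum (b := fun t => (\sum_b (c b * w b t)%:E)%E)); last first.
    move=> t _; rewrite sumEFin (bigD1 (trunc n t))//= big1 ?addr0.
      by rewrite /c /w eqxx /W; case: ifP => _; rewrite ?mul0r// mulrC.
    by move=> b; rewrite /w eq_sym => /negbTE ->; rewrite mulr0.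
  rewrite esum_sum; last by move=> t b _ _; rewrite lee_fin mulr_ge0.
  rewrite /V -sumEFin; apply: lee_sum => b _; rewrite -/(c b).
  under eq_esum do rewrite EFinM.
  rewrite esumZl//; last by move=> t; rewrite lee_fin.
  rewrite -[leRHS]mule1; apply: lee_wpmul2l; first by rewrite lee_fin.
  exact: (tail_wt_sum hp).
(* Each cell of clock [b] has mass at most [Q b * delta] and [delta] times the sum of the [v j] is
   at most [Z], so [b] contributes at most [Q b]. *)
have V1 : \sum_y mu y * V y <= 1.
  under eq_bigr do rewrite /V mulr_sumr.
  rewrite exchange_big/=.
  have <- : \sum_b Q b = 1.
    by apply: EFin_inj; rewrite -sumEFin -(esum_dist hp g) esum_fin.
  apply: ler_sum => b _; case: ltP => Qb; last by rewrite big1// => y _; rewrite mulr0.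
  rewrite /mu (cell1_sum Q delta K b (fun j => v j / Z)).
  apply: (@le_trans _ _ (\sum_(j < K.+1) Q b * delta * (v j / Z))).
    apply: ler_sum => j _; rewrite ler_wpM2r ?divr_ge0 ?(ltW (v0 j)) ?(ltW Z0)//.
    by apply: cell1_le => //; exact: KQ.
  rewrite -mulr_sumr -mulr_suml mulrA -mulrA -[leRHS]mulr1 -!mulrA ler_wpM2l//.
  by rewrite mulrA ler_pdivrMr// mul1r.
pose G u (y : L) : R :=
  (if (n <= pickle (rT u))%N then self_info p rT u else 0) +
  (1 + sigma) * log2 (B (y (g u)) / bb).
have s1 : 0 <= 1 + sigma by rewrite addr_ge0// ltW.
have tail0 u : 0 <= (if (n <= pickle (rT u))%N then self_info p rT u else 0).
  by case: ifP => // _; exact: (self_info_ge0 hp).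
have G0 u y : 0 <= G u y by rewrite addr_ge0// mulr_ge0.
have WG u y : 0 < p u -> 0 < k u y ->
    0 < W (rT u) y /\ - log2 (W (rT u) y) <= G u y + log2 (bb * lam).
  move=> pu _; have Qu : 0 < Q (g u) := dist_gt0 hp g pu.
  have wt0 : 0 < tail_wt p n rT (rT u).
    by rewrite /tail_wt; case: ifP => // _; exact: (dist_gt0 hp).
  rewrite /W -/(g u) Qu mulr_gt0 ?divr_gt0//; split=> //.
  rewrite log2M ?divr_gt0// log2_div// lam_log.
  have -> : log2 (v (y (g u))) = - (1 + sigma) * log2 (B (y (g u))).
    by rewrite /log2 ln_powR mulrA.
  rewrite /G log2_div// log2M//.
  have : - log2 (tail_wt p n rT (rT u)) <=
      if (n <= pickle (rT u))%N then self_info p rT u else 0.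
    by rewrite /tail_wt; case: ltnP => // _; rewrite /log2 ln1 mul0r oppr0.
  by move: (if _ then _ else _) => tl; lra.
have muE := fun y => marginal_of_indep hp (k0^~ y) (mu0 y) (ind^~ y).
have code := @centropy_lift _ _ _ _ _ hp _ y0 _ k0 k1 _ rT mu W V G (log2 (bb * lam)) muE.
apply: le_trans (code W0 G0 V0 WG WV V1) _; rewrite leeD2r//.
rewrite -(ExZ hp)// -(ExD hp)//; last by move=> u; rewrite mulr_ge0.
apply: (le_Ex hp) => u _; rewrite /G /lB mulr_sumr.
rewrite -[X in _ <= X + _]mul1r -(k1 u) mulr_suml -big_split/=.
by apply: ler_sum => y _; rewrite -/sigma; lra.
Qed.

Lemma race_code (e : R) :
  entropy p rT \is a fin_num -> 0 < e ->
  let I := Hr p rT - Hcr p rT f in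
  exists2 q, is_kernel q &
  centropy (joint p q) (fun w => f w.1) Y = entropy p f /\
  (centropy (joint p q) (fun w => rT w.1) Y <=
   (I + log2 (I + 551 / 100) + 106 / 100 + e)%:E)%E.
Proof.
move=> fT e0 I; have fTf : centropy p rT f \is a fin_num.
  rewrite ge0_fin_numE ?(centropy_ge0 hp)//.
  by rewrite (le_lt_trans (centropy_le hp rT f))// ltey_eq fT.
have I0 : 0 <= I by rewrite subr_ge0 fine_le// (centropy_le hp).
have l27 : 0 < log2 27 :> R by rewrite /log2 divr_gt0 ?ln2_gt0// ln_gt0//; lra.
pose lam := (I + log2 27) * ln 2.
have lam0 : 0 < lam by rewrite mulr_gt0 ?ln2_gt0// ltr_wpDl.
have fT' := fT; rewrite (entropyE hp) in fT'.
have [n hn] := Ex_tail hp (pickle \o rT) (self_info_ge0 hp rT) fT' e0.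
have [q qk [q1 [E [EI E0] q2]]] := race_bound n lam0.
exists q => //; split=> //; apply: (le_trans q2).
have EI' : (E <= (I + log2 27)%:E)%E.
  move: EI; rewrite -leeBrDr// => /le_trans; apply.
  by rewrite -(fineK fT) -(fineK fTf) -!EFinD lee_fin /I /Hr /Hcr; lra.
apply: (@le_trans _ _ (e%:E + (1 + lam^-1)%:E * (I + log2 27)%:E +
    (log2 (25^-1 * lam))%:E)%E).
  rewrite leeD2r// leeD// lee_wpmul2l// lee_fin addr_ge0// invr_ge0 ltW//.
rewrite -EFinM -!EFinD lee_fin.
by have := redundancy_le I0; rewrite -/lam; lra.
Qed.

End RaceCode.

(** * Feasible representations and the bounds *)

Section Assembly.
Context {R : realType} {S : finType} {X T : countType}.
Context {p : S * X * T -> R} (hp : is_pmf p).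
Local Notation Om := (S * X * T)%type.
Local Notation Y := (@yY S X T).
Local Notation rS := (@rvS S X T).
Local Notation rX := (@rvX S X T).
Local Notation rT := (@rvT S X T).
Local Notation rXS := (@rvXS S X T).

Lemma centropy_fin (W : choiceType) (P : W -> R) (A B : choiceType)
    (f : W -> A) (g : W -> B) :
  is_pmf P -> entropy P f \is a fin_num -> centropy P f g \is a fin_num.
Proof.
move=> hP fA; rewrite ge0_fin_numE ?(centropy_ge0 hP)//.
by rewrite (le_lt_trans (centropy_le hP f g))// ltey_eq fA.
Qed.

Definition info (q : Om -> nat -> R) (A : choiceType) (f : Om -> A) : R :=
  Hr p f - Hcr (joint p q) (fun w => f w.1) Y.

(** Chain rule for [(f, g)] in both orders. *)
Lemma entropy_exchange (A B : choiceType) (f : Om -> A) (g : Om -> B) :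
  entropy p f \is a fin_num -> entropy p g \is a fin_num ->
  Hr p f - Hr p g = Hcr p f g - Hcr p g f.
Proof.
move=> ff fg; have ffg := centropy_fin g hp ff; have fgf := centropy_fin f hp fg.
have := congr1 fine (entropy_swap hp f g).
by rewrite !(entropy_pair hp) !fineD// /Hr /Hcr; lra.
Qed.

Section OneVariable.
Context {A : choiceType} (f : Om -> A) (fA : entropy p f \is a fin_num).

Lemma centropy_joint_fin q : is_kernel q ->
  centropy (joint p q) (fun w => f w.1) Y \is a fin_num.
Proof.
by move=> qk; apply: (centropy_fin _ (joint_pmf hp qk)); rewrite (entropy_joint hp).
Qed.

Lemma minfo_jointE q : is_kernel q ->
  minfo (joint p q) (fun w => f w.1) Y = (info q f)%:E.
Proof.
move=> qk; rewrite /minfo (entropy_joint hp f qk) /info EFinB.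
by rewrite /Hr /Hcr !fineK// centropy_joint_fin.
Qed.

Lemma info_le q : is_kernel q -> info q f <= Hr p f.
Proof.
by move=> qk; rewrite gerBl fine_ge0// (centropy_ge0 (joint_pmf hp qk)).
Qed.

Lemma info_indep q : centropy (joint p q) (fun w => f w.1) Y = entropy p f ->
  info q f = 0.
Proof. by move=> e; rewrite /info /Hcr e subrr. Qed.

Lemma info_time_share lam q0 q1 : 0 <= lam <= 1 -> is_kernel q0 -> is_kernel q1 ->
  info (time_share lam q0 q1) f = (1 - lam) * info q0 f + lam * info q1 f.
Proof.
move=> l01 k0 k1; rewrite /info /Hcr (centropy_time_share hp f l01 k0 k1).
have [f0 f1] := (centropy_joint_fin k0, centropy_joint_fin k1).
rewrite -(fineK f0) -(fineK f1) -!EFinM -EFinD /=; ring.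
Qed.

(** [centropy_triangle], with [H(g|f)] traded for [H(f|g)] by [entropy_exchange]. *)
Lemma info_triangle q (B : choiceType) (g : Om -> B) :
  entropy p g \is a fin_num -> is_kernel q ->
  info q f <= info q g + Hcr p f g.
Proof.
move=> fB qk; have jp := joint_pmf hp qk.
have tri := centropy_triangle jp (fun w => f w.1) (fun w => g w.1) Y.
rewrite (centropy_joint hp g f qk) in tri.
have gf := centropy_fin f hp fB; have fY := centropy_joint_fin qk.
have gY : centropy (joint p q) (fun w => g w.1) Y \is a fin_num.
  by apply: (centropy_fin _ jp); rewrite (entropy_joint hp).
have := entropy_exchange fA fB; move: tri.
rewrite /info /Hr /Hcr -(fineK gf) -(fineK fY) -(fineK gY) -EFinD lee_fin.
by rewrite /=; lra.
Qed.

End OneVariable.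

Definition reveal_T (u : Om) (i : nat) : R := (i == pickle (rT u))%:R.

Lemma reveal_T_kernel : is_kernel reveal_T.
Proof.
split=> u; first by move=> i; rewrite /reveal_T; case: eqP.
rewrite (esumID [set pickle (rT u)]); last by move=> i _; rewrite lee_fin /reveal_T; case: eqP.
rewrite [X in (_ + X)%E]esum1 ?adde0; last first.
  by move=> i [_ /= /eqP iu]; rewrite /reveal_T (negbTE iu).
by rewrite setTI esum_set1 /reveal_T ?eqxx// lee_fin.
Qed.

Lemma info_reveal_T : info reveal_T rT = Hr p rT.
Proof.
have jp := joint_pmf hp reveal_T_kernel.
suff c0 : centropy (joint p reveal_T) (fun w => rT w.1) Y = 0%E.
  by rewrite /info /Hcr c0 subr0.
apply/eqP; rewrite eq_le (centropy_ge0 jp) andbT.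
have -> : 0%E = (Ex (joint p reveal_T) (fun=> 0%R) + 0%:E)%E.
  by rewrite (Ex_cst jp)// adde0.
apply: (centropy_code jp (W := fun t i => (i == pickle t)%:R)) => //.
- move=> w; rewrite /joint /reveal_T -[w.2]/(Y w).
  case: (Y w =P pickle _) => _; last by rewrite mulr0 ltxx.
  by split=> //; rewrite /log2 ln1 mul0r oppr0 addr0.
- rewrite -(esum_dist jp Y); apply: le_esum => i _.
  have d0 := dist_ge0 jp Y i.
  have [[t ti]|nt] := pselect (exists t : T, pickle t = i); last first.
    rewrite esum1 ?lee_fin// => t _; case: eqP => [it|_]; last by rewrite mul0r.
    by exfalso; apply: nt; exists t.
  rewrite (esumID [set t]); last by move=> t' _; rewrite lee_fin mulr_ge0.
  rewrite setTI esum_set1 ?lee_fin ?mulr_ge0// esum1 ?adde0.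
    by rewrite lee_fin ler_piMl// lern1 leq_b1.
  move=> t' [_ /= tt']; case: eqP => [it|_]; last by rewrite mul0r.
  by exfalso; apply: tt'; apply: (pcan_inj pickleK); rewrite ti it.
Qed.

Hypothesis fS : entropy p rS \is a fin_num.
Hypothesis fX : entropy p rX \is a fin_num.
Hypothesis fT : entropy p rT \is a fin_num.

(** Reveal [T] for the fraction [c / H(f)] of the time and use independent copies otherwise:
    revealing [T] leaks at most [H(f)] about [f], and it gains [H(f)] over the copies. *)
Lemma leak (A : countType) (f : Om -> A) (c e : R) :
  entropy p f \is a fin_num -> 0 <= c < Hr p f -> 0 < e ->
  exists2 q, is_kernel q &
    info q f <= c /\ Hr p rT - Hr p f + c - e <= info q rT.
Proof.
move=> fA /andP[c0 cH] e0.
have H0 : 0 < Hr p f by apply: le_lt_trans cH.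
have [q0 k0 [/info_indep i0 t0]] := independent_copies hp fA fT e0.
pose lam := c / Hr p f.
have lam01 : 0 <= lam <= 1.
  by rewrite divr_ge0 ?(ltW H0)//= ler_pdivrMr// mul1r ltW.
have lamH : lam * Hr p f = c by rewrite divfK// gt_eqF.
exists (time_share lam q0 reveal_T).
  exact: time_share_kernel reveal_T_kernel.
rewrite !info_time_share//; try exact: reveal_T_kernel.
have t0' : Hr p rT - Hr p f - e <= info q0 rT.
  move: t0; rewrite /info -(fineK (centropy_joint_fin fT k0)) -(fineK fA) -EFinD lee_fin.
  by rewrite /Hr /Hcr; lra.
have r1 := info_le f reveal_T_kernel.
move: lam01 => /andP[l0 l1].
rewrite i0 info_reveal_T; split; first by rewrite mulr0 add0r -lamH ler_wpM2l.
have : (1 - lam) * (Hr p rT - Hr p f - e) <= (1 - lam) * info q0 rT.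
  by rewrite ler_wpM2l// subr_ge0.
have : 0 <= lam * e by rewrite mulr_ge0// ltW.
by rewrite -lamH; lra.
Qed.

Lemma entropy_rXS : entropy p rXS = (entropy p rS + centropy p rX rS)%E.
Proof. exact: (entropy_pair hp rX rS). Qed.

Lemma entropy_XS_fin : entropy p rXS \is a fin_num.
Proof. by rewrite entropy_rXS fin_numD fS (centropy_fin _ hp). Qed.

Lemma Hr_XS : Hr p rXS = Hr p rS + Hcr p rX rS.
Proof. by rewrite /Hr /Hcr entropy_rXS fineD// (centropy_fin _ hp). Qed.

Lemma Hr_XS_swap : Hr p rXS = Hr p rX + Hcr p rS rX.
Proof.
have -> : Hr p rXS = fine (entropy p rX + centropy p rS rX)%E.
  congr fine; rewrite -(entropy_pair hp); exact: (entropy_swap hp rX rS).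
by rewrite /Hr /Hcr fineD// (centropy_fin _ hp).
Qed.


Context {r eps : R}.
Local Notation g := (g_priv p r eps).

Lemma g_priv_ge q : is_kernel q -> info q rS <= eps -> info q rX <= r ->
  ((info q rT)%:E <= g)%E.
Proof.
move=> qk qS qX; rewrite -(minfo_jointE fT qk).
apply: ereal_sup_ubound; exists q => //; split=> //.
have mS := minfo_jointE fS qk; have mX := minfo_jointE fX qk.
by split; [rewrite -lee_fin -mS in qS|rewrite -lee_fin -mX in qX].
Qed.

Lemma g_priv_ge_approx (x : R) :
  (forall e, 0 < e -> exists2 q, is_kernel q &
    [/\ info q rS <= eps, info q rX <= r & x - e <= info q rT]) ->
  (x%:E <= g)%E.
Proof.
move=> H; apply/lee_addgt0Pr => e e0; have [q qk [qS qX qT]] := H e e0.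
rewrite -leeBlDr//; apply: le_trans (g_priv_ge qk qS qX).
by rewrite -EFinB lee_fin.
Qed.

Lemma g_priv_le : (g <= (Num.min (Hcr p rT rS + eps) (Hcr p rT rX + r))%:E)%E.
Proof.
apply: ge_ereal_sup => _ [q [qk [qS qX]] <-].
have mS := minfo_jointE fS qk; have mX := minfo_jointE fX qk.
have mT := minfo_jointE fT qk.
have {}qS : info q rS <= eps by rewrite -lee_fin -mS.
have {}qX : info q rX <= r by rewrite -lee_fin -mX.
rewrite [minfo _ _ _]mT lee_fin le_min.
have := info_triangle fT fS qk; have := info_triangle fT fX qk.
by move=> tX tS; apply/andP; split; lra.
Qed.

(** [S] is a function of [(X, S)], so the conditional entropy in [info_triangle] vanishes. *)
Lemma info_XS_S q : is_kernel q -> info q rXS = 0 -> info q rS <= 0.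
Proof.
move=> qk q0; have := info_triangle fS entropy_XS_fin qk; rewrite q0 add0r.
by rewrite /Hcr (centropy_fun hp snd rXS).
Qed.

Lemma info_XS_X q : is_kernel q -> info q rXS = 0 -> info q rX <= 0.
Proof.
move=> qk q0; have := info_triangle fX entropy_XS_fin qk; rewrite q0 add0r.
by rewrite /Hcr (centropy_fun hp fst rXS).
Qed.

(** Utilities approached by representations independent of [(X, S)], which fit any nonnegative
    budgets; they are the partners for time sharing. *)
Definition hidden_value (x : R) := forall e, 0 < e ->
  exists2 q, is_kernel q & info q rXS = 0 /\ x - e <= info q rT.

Let HT := Hr p rT.
Let HXS := Hr p rXS.
Let HT_XS := Hcr p rT rXS.
Let HXS_T := Hcr p rXS rT.
Let I := Hr p rT - Hcr p rT rXS.
Let L0 := HT_XS - (log2 (I + 551 / 100) + 106 / 100).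

Lemma hidden_copies : hidden_value (HT - HXS).
Proof.
move=> e e0; have [q qk [/info_indep q0 qT]] := independent_copies hp entropy_XS_fin fT e0.
exists q => //; split=> //; move: qT.
rewrite -(fineK (centropy_joint_fin fT qk)) -(fineK entropy_XS_fin) -EFinD lee_fin.
by rewrite /info /HT /HXS /Hr /Hcr; lra.
Qed.

Lemma hidden_race : hidden_value L0.
Proof.
move=> e e0; have [q qk [/info_indep q0 qT]] := race_code hp (f := rXS) fT e0.
exists q => //; split=> //; move: qT.
rewrite -(fineK (centropy_joint_fin fT qk)) lee_fin.
by rewrite /info /L0 /HT_XS /I /Hr /Hcr; lra.
Qed.

Lemma g_priv_ge_hidden x : 0 <= r -> 0 <= eps -> hidden_value x -> (x%:E <= g)%E.
Proof.
move=> r0 eps0 hx; apply: g_priv_ge_approx => e /hx[q qk [q0 qT]].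
exists q => //; split=> //.
- exact: le_trans (info_XS_S qk q0) eps0.
- exact: le_trans (info_XS_X qk q0) r0.
Qed.

(* Time sharing between a representation that is independent of [(X, S)]
   and one that leaks [eps] bits about [S]. *)
Lemma g_priv_ge_share_S x a : 0 <= eps < Hr p rS -> hidden_value x ->
  0 <= a <= 1 -> a * (Hcr p rX rS + eps) <= r ->
  (((1 - a) * x + a * (HT - Hr p rS + eps))%:E <= g)%E.
Proof.
move=> /[dup] eps01 /andP[eps0 _] hx /[dup] a01 /andP[a0 a1] ar.
apply: g_priv_ge_approx => e e0.
have [q0 k0 [q00 q0T]] := hx e e0.
have [q1 k1 [q1S q1T]] := leak fS eps01 e0.
(* Leaking at most [eps] about [S] leaks at most [H(X|S) + eps] about [X]. *)
have q1X := info_triangle fX fS k1.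
have q0S := info_XS_S k0 q00; have q0X := info_XS_X k0 q00.
have a1' : 0 <= 1 - a by rewrite subr_ge0.
exists (time_share a q0 q1); first exact: time_share_kernel.
rewrite !info_time_share//; split.
- apply: (@le_trans _ _ ((1 - a) * 0 + a * eps)); first by rewrite lerD// ler_wpM2l.
  by rewrite mulr0 add0r ler_piMl.
- apply: (@le_trans _ _ ((1 - a) * 0 + a * (Hcr p rX rS + eps))); last by rewrite mulr0 add0r.
  by rewrite lerD// ler_wpM2l//; lra.
- apply: (@le_trans _ _ ((1 - a) * (x - e) + a * (HT - Hr p rS + eps - e))).
    by rewrite le_eqVlt; apply/orP; left; apply/eqP; ring.
  by rewrite lerD// ler_wpM2l.
Qed.

(** The preceding argument with [X] and [S] exchanged. *)
Lemma g_priv_ge_share_X x a : 0 <= r < Hr p rX -> hidden_value x ->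
  0 <= a <= 1 -> a * (Hcr p rS rX + r) <= eps ->
  (((1 - a) * x + a * (HT - Hr p rX + r))%:E <= g)%E.
Proof.
move=> /[dup] r01 /andP[r0 _] hx /[dup] a01 /andP[a0 a1] ar.
apply: g_priv_ge_approx => e e0.
have [q0 k0 [q00 q0T]] := hx e e0.
have [q1 k1 [q1X q1T]] := leak fX r01 e0.
have q1S := info_triangle fS fX k1.
have q0S := info_XS_S k0 q00; have q0X := info_XS_X k0 q00.
have a1' : 0 <= 1 - a by rewrite subr_ge0.
exists (time_share a q0 q1); first exact: time_share_kernel.
rewrite !info_time_share//; split.
- apply: (@le_trans _ _ ((1 - a) * 0 + a * (Hcr p rS rX + r))); last by rewrite mulr0 add0r.
  by rewrite lerD// ler_wpM2l//; lra.
- apply: (@le_trans _ _ ((1 - a) * 0 + a * r)); first by rewrite lerD// ler_wpM2l.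
  by rewrite mulr0 add0r ler_piMl.
- apply: (@le_trans _ _ ((1 - a) * (x - e) + a * (HT - Hr p rX + r - e))).
    by rewrite le_eqVlt; apply/orP; left; apply/eqP; ring.
  by rewrite lerD// ler_wpM2l.
Qed.

(* Concavity of [log2] between the arguments [I + 551/100] and
   [min HT HXS + 551/100]. *)
Lemma share_bound a c : 0 <= a <= 1 ->
  HT_XS + c - a * HXS_T - 106 / 100
    - log2 ((1 - a) * I + a * Num.min HT HXS + 551 / 100) <=
  (1 - a) * L0 + (a * (HT - HXS) + c).
Proof.
move=> /andP[a0 a1]; set m := Num.min HT HXS.
have m0 : 0 <= m by rewrite le_min !fine_ge0// (entropy_ge0 hp).
have I0 : 0 <= I by rewrite subr_ge0 fine_le// ?(centropy_le hp)// (centropy_fin _ hp).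
have ex := entropy_exchange fT entropy_XS_fin.
have [c0 cm cI] : [/\ 0 < 551 / 100 :> R, 0 < m + 551 / 100 & 0 < I + 551 / 100].
  by split; lra.
pose k b := if b then a else 1 - a.
pose z b := if b then m + 551 / 100 else I + 551 / 100.
have k0 b : 0 <= k b by case: b; rewrite /k ?subr_ge0.
have k1 : \sum_b k b = 1 by rewrite big_bool /k/= addrC subrK.
have z0 b : 0 < z b by case: b.
have : a * log2 (m + 551 / 100) + (1 - a) * log2 (I + 551 / 100) <=
    log2 (a * (m + 551 / 100) + (1 - a) * (I + 551 / 100)).
  by have := log2_concave k0 k1 z0; rewrite !big_bool.
have -> : a * (m + 551 / 100) + (1 - a) * (I + 551 / 100) =
    (1 - a) * I + a * m + 551 / 100 by ring.
(* This term of the concavity bound is nonnegative and is dropped. *)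
have : 0 <= a * log2 (m + 551 / 100) by rewrite mulr_ge0// log2_ge0//; lra.
have -> : HT - HXS = HT_XS - HXS_T by [].
by rewrite /L0; lra.
Qed.

End Assembly.

(** * Upper bound and the four regimes of lower bounds *)

Theorem theorem2 (R : realType) (S : finType) (X T : countType)
  (p : S * X * T -> R) (hp : is_pmf p)
  (hHS : entropy p (@rvS S X T) \is a fin_num)
  (hHX : entropy p (@rvX S X T) \is a fin_num)
  (hHT : entropy p (@rvT S X T) \is a fin_num)
  (r eps : R) (hr0 : 0 <= r) (he0 : 0 <= eps)
  (hrX : r < Hr p (@rvX S X T)) (heS : eps < Hr p (@rvS S X T)) :
  let g := g_priv p r eps in
  let HT := Hr p (@rvT S X T) in
  let HXS := Hr p (@rvXS S X T) in
  let HT_S := Hcr p (@rvT S X T) (@rvS S X T) in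
  let HT_X := Hcr p (@rvT S X T) (@rvX S X T) in
  let HT_XS := Hcr p (@rvT S X T) (@rvXS S X T) in
  let HXS_T := Hcr p (@rvXS S X T) (@rvT S X T) in
  let HX_S := Hcr p (@rvX S X T) (@rvS S X T) in
  let HS_X := Hcr p (@rvS S X T) (@rvX S X T) in
  let HS_T := Hcr p (@rvS S X T) (@rvT S X T) in
  let HX_T := Hcr p (@rvX S X T) (@rvT S X T) in
  let IXST := Ir p (@rvT S X T) (@rvXS S X T) in
  let L0 := HT_XS - (log2 (IXST + 551/100) + 106/100) in
  [/\ (g <= (Num.min (HT_S + eps) (HT_X + r))%:E)%E,
      (r <= HX_S + eps ->
        let a := r / (HX_S + eps) in
        let L1 := HT_XS + r - HXS_T in
        let L2 := HT_XS + r - a * HXS_T - 106/100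
                  - log2 ((1 - a) * IXST + a * Num.min HT HXS + 551/100) in
        ((Num.max L0 (Num.max L1 L2))%:E <= g)%E),
      (HX_S + eps <= r ->
        let L1' := HT_S - HS_T + eps in
        ((Num.max L0 L1')%:E <= g)%E),
      (r <= eps -> eps <= HS_X + r ->
        let a := eps / (HS_X + r) in
        let L3 := HT_XS + eps - HXS_T in
        let L4 := HT_XS + eps - a * HXS_T - 106/100
                  - log2 ((1 - a) * IXST + a * Num.min HT HXS + 551/100) in
        ((Num.max L0 (Num.max L3 L4))%:E <= g)%E) &
      (HS_X + r <= eps ->
        let L3' := HT_X - HX_T + r in
        ((Num.max L0 L3')%:E <= g)%E)].
Proof.
have fXS := entropy_XS_fin hp hHS hHX.
have fTXS := centropy_fin (@rvXS S X T) hp hHT.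
have IE : Ir p (@rvT S X T) (@rvXS S X T) =
    Hr p (@rvT S X T) - Hcr p (@rvT S X T) (@rvXS S X T).
  by rewrite /Ir /minfo fineB.
have hr : 0 <= r < Hr p (@rvX S X T) by rewrite hr0.
have he : 0 <= eps < Hr p (@rvS S X T) by rewrite he0.
have HXS1 := Hr_XS hp hHS hHX; have HXS2 := Hr_XS_swap hp hHS hHX.
have ex := entropy_exchange hp hHT fXS.
have exS := entropy_exchange hp hHT hHS; have exX := entropy_exchange hp hHT hHX.
have HX_S0 : 0 <= Hcr p (@rvX S X T) (@rvS S X T) by rewrite fine_ge0// (centropy_ge0 hp).
have HS_X0 : 0 <= Hcr p (@rvS S X T) (@rvX S X T) by rewrite fine_ge0// (centropy_ge0 hp).
(* For [d = 0] this holds because [c = 0] and [c / 0 = 0]. *)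
have ratio (c d : R) : 0 <= c <= d -> 0 <= c / d <= 1 /\ c / d * d = c.
  move=> /andP[c0 cd]; have := le_trans c0 cd; rewrite le_eqVlt => /predU1P[d0|d0].
    have -> : c = 0 by apply/eqP; rewrite eq_le c0 d0 cd.
    by rewrite !mul0r lexx ler01.
  by rewrite divr_ge0 ?(ltW d0)// ler_pdivrMr// mul1r cd divfK// gt_eqF.
have maxE (x y : R) (z : \bar R) : (x%:E <= z)%E -> (y%:E <= z)%E ->
    ((Num.max x y)%:E <= z)%E.
  by move=> xz yz; rewrite /Num.max; case: ifP.
move=> g HT HXS HT_S HT_X HT_XS HXS_T HX_S HS_X HS_T HX_T IXST L0.
have copies := @hidden_copies _ _ _ _ _ hp hHS hHX hHT.
have race := @hidden_race _ _ _ _ _ hp hHT.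
have L0g : (L0%:E <= g)%E.
  by rewrite /L0 /IXST IE; exact: (g_priv_ge_hidden hp hHS hHX hHT hr0 he0 race).
have shareS x a := @g_priv_ge_share_S _ _ _ _ _ hp hHS hHX hHT r _ x a he.
have shareX x a := @g_priv_ge_share_X _ _ _ _ _ hp hHS hHX hHT _ eps x a hr.
have bound := share_bound hp hHS hHX hHT.
split=> //.
- exact: g_priv_le.
- move=> rD; cbv zeta; set a := r / (HX_S + eps).
  have [a01 aD] : 0 <= a <= 1 /\ a * (HX_S + eps) = r by apply: ratio; rewrite hr0.
  (* By [H(X,S) = H(S) + H(X|S)], as [a] is the ratio at which the bound on the leakage about [X]
     equals [r]. *)
  have value : a * (HT - Hr p (@rvS S X T) + eps) = a * (HT - HXS) + r.
    by rewrite -aD /HXS /HX_S HXS1; ring.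
  have aD' : a * (HX_S + eps) <= r by rewrite aD.
  (* [L1] comes from sharing with independent copies, [L2] from sharing with the race. *)
  apply: (maxE _ _ _ L0g); apply: maxE.
    apply: le_trans (shareS _ _ copies a01 aD'); rewrite lee_fin value.
    by rewrite /HT_XS /HXS_T /HT /HXS; lra.
  apply: le_trans (shareS _ _ race a01 aD'); rewrite lee_fin value.
  by rewrite /IXST IE; exact: bound.
- move=> rD; cbv zeta; apply: (maxE _ _ _ L0g).
  (* The budget [r] allows leaking [eps] bits about [S] all the time, so the ratio is 1. *)
  have a01 : 0 <= (1 : R) <= 1 by rewrite ler01 lexx.
  have aD : 1 * (HX_S + eps) <= r by rewrite mul1r.
  apply: le_trans (shareS _ _ copies a01 aD); rewrite lee_fin.
  by rewrite /HT_S /HS_T; lra.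
- move=> _ eD; cbv zeta; set a := eps / (HS_X + r).
  have [a01 aD] : 0 <= a <= 1 /\ a * (HS_X + r) = eps by apply: ratio; rewrite he0.
  have value : a * (HT - Hr p (@rvX S X T) + r) = a * (HT - HXS) + eps.
    by rewrite -aD /HXS /HS_X HXS2; ring.
  have aD' : a * (HS_X + r) <= eps by rewrite aD.
  apply: (maxE _ _ _ L0g); apply: maxE.
    apply: le_trans (shareX _ _ copies a01 aD'); rewrite lee_fin value.
    by rewrite /HT_XS /HXS_T /HT /HXS; lra.
  apply: le_trans (shareX _ _ race a01 aD'); rewrite lee_fin value.
  by rewrite /IXST IE; exact: bound.
- move=> eD; cbv zeta; apply: (maxE _ _ _ L0g).
  have a01 : 0 <= (1 : R) <= 1 by rewrite ler01 lexx.
  have aD : 1 * (HS_X + r) <= eps by rewrite mul1r.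
  apply: le_trans (shareX _ _ copies a01 aD); rewrite lee_fin.
  by rewrite /HT_X /HX_T; lra.
Qed.
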